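(* Let $p\ge3$. For every $\gamma\in\mathrm{int}_{C^2}(\mathcal{H}_{\ge p})$, the closure $\overline{\mathrm{Per}_{\mathcal{H}}(T_\gamma)}$ of the set of hyperbolic periodic points of $T_\gamma$ is a hyperbolic set of $T_\gamma$.
   Context: Tables. Let $\mathbb{S}=\mathbb{R}/2\pi\mathbb{Z}$. $\mathcal{S}$ denotes the set of strongly convex planar billiard tables with $C^\infty$ boundary; a table is identified with a $C^\infty$ regular injective parametrization $\gamma:\mathbb{S}\to\mathbb{R}^2$ of its boundary $\Gamma=\gamma(\mathbb{S})$, which is oriented counterclockwise and has everywhere strictly positive curvature. Symplectic billiard. For $t\in\mathbb{S}$, $t^*\ne t$ is the unique parameter with $\det(\gamma'(t),\gamma'(t^* ))=0$. The phase space is $\hat{\mathcal{P}}_\gamma=\{(\gamma(t_1),\gamma(t_2)): t_1<t_2<t_1^*\}$ (cyclic counterclockwise order). The symplectic billiard map is $\hat T_\gamma(\gamma(t_1),\gamma(t_2))=(\gamma(t_2),\gamma(t_3))$, where $\gamma(t_3)$ is the unique point of $\Gamma$ with $(\gamma(t_2),\gamma(t_3))\in\hat{\mathcal{P}}_\gamma$ and $\det(\gamma'(t_2),\gamma(t_3)-\gamma(t_1))=0$. Coordinates. Fix an origin $O$ in the interior of the table, let $L(t_1,t_2)=\det(\gamma(t_1)-O,\gamma(t_2)-O)$ and let $L_1,L_2$ be its partial derivatives. Then $(t_1,s_1)$ with $s_1=-L_1(t_1,t_2)$ are coordinates on the phase space, which becomes $\mathcal{P}_\gamma=\{(t,s):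 -L_1(t,t^* )<s<-L_1(t,t)\}\subset\mathbb{S}\times\mathbb{R}$; in them the map is $T_\gamma:\mathcal{P}_\gamma\to\mathcal{P}_\gamma$, $(t_1,-L_1(t_1,t_2))\mapsto(t_2,L_2(t_1,t_2))$. It preserves $ds\wedge dt$. Definitions. A periodic point $x$ of $T_\gamma$ of least period $n$ is hyperbolic if $DT_\gamma^n(x)$ has no eigenvalue of modulus $1$. $\mathrm{Per}_{\mathcal{H}}(T_\gamma)$ is the set of hyperbolic periodic points of $T_\gamma$. $\mathcal{H}_{\ge p}$ is the set of $\gamma\in\mathcal{S}$ such that all periodic points of $T_\gamma$ of period $\ge p$ are hyperbolic, and $\mathrm{int}_{C^2}(\mathcal{H}_{\ge p})$ is its interior in $\mathcal{S}$ for the $C^2$ topology. A compact invariant subset $\Lambda$ of $\mathcal{P}_\gamma$ is a hyperbolic set of $T_\gamma$ if there exist a $DT_\gamma$-invariant continuous splitting of the tangent bundle $T_\Lambda\mathcal{P}_\gamma=E^s_\Lambda\oplus E^u_\Lambda$ and $m\in\mathbb{N}$ such that $\|DT_\gamma^m(x)|_{E^s_x}\|\le\frac12$ and $\|DT_\gamma^{-m}(x)|_{E^u_x}\|\le\frac12$ for all $x\in\Lambda$. *)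

(* Defs.v *)
(* MathComp + MathComp-Analysis. *)
From mathcomp Require Import all_boot all_order all_algebra.
From mathcomp Require Import all_classical all_reals all_analysis.
From mathcomp Require Import complex.

Set Implicit Arguments.
Unset Strict Implicit.
Unset Printing Implicit Defensive.

Import Order.TTheory GRing.Theory Num.Theory.
Import numFieldNormedType.Exports.

Local Open Scope ring_scope.
Local Open Scope classical_set_scope.
Local Open Scope quotient_scope.

(* The circle R / 2 pi Z, with the quotient topology. *)
Section circle.
Variable R : realType.

Definition circle_rel (s t : R) : bool := (t - s) / (2 * pi) \is a Num.int.

Lemma circle_rel_equiv : equiv_class_of circle_rel.
Proof.
split=> [t|s t|t s u]; rewrite /circle_rel.
- by rewrite subrr mul0r int_num0.
- by rewrite -(opprB t s) mulNr rpredN.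
- move=> st tu; have -> : u - s = (u - t) + (t - s) by rewrite addrA subrK.
  by rewrite mulrDl rpredD.
Qed.

Canonical circle_equivRel := EquivRelPack circle_rel_equiv.

Definition circle : Type := quotient_topology {eq_quot circle_equivRel}.

Definition to_circle (t : R) : circle := \pi_circle t.

End circle.
Arguments to_circle {R} t.

Section tables.
Variable R : realType.
Implicit Types (u v o : 'rV[R]_2) (gamma : circle R -> 'rV[R]_2) (s t : R).

Definition det2 u v : R := \det (\matrix_(i < 2) (if i == 0 then u else v)).

(* The Euclidean norm; `|v| is the sup norm. *)
Definition enorm v : R := Num.sqrt (\sum_(i < 2) v 0 i ^+ 2).

Definition lift_curve gamma : R -> 'rV[R]_2 := gamma \o to_circle.

Definition dcurve gamma (k : nat) : R -> 'rV[R]_2 := derive1n k (lift_curve gamma).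

Definition smooth gamma := forall n t, derivable (dcurve gamma n) t 1.

Definition regular gamma := forall t, dcurve gamma 1 t != 0.

Definition curvature gamma t : R :=
  det2 (dcurve gamma 1 t) (dcurve gamma 2 t) /
    enorm (dcurve gamma 1 t) ^+ 3.

Definition convex_hull (A : set 'rV[R]_2) : set 'rV[R]_2 :=
  \bigcap_(C in [set C | convex_set C /\ A `<=` C]) C.

Definition table gamma : set 'rV[R]_2 := convex_hull (range gamma).

(* The curve turns to the left around each point of the interior, which for
   the boundary of a convex table is the counterclockwise orientation. *)
Definition counterclockwise gamma :=
  forall o, (table gamma)° o ->
  forall t, 0 < det2 (lift_curve gamma t - o) (dcurve gamma 1 t).

Definition tables : set (circle R -> 'rV[R]_2) := [set gamma |
  [/\ smooth gamma, regular gamma, injective gamma,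
      counterclockwise gamma & forall t, 0 < curvature gamma t]].

Definition C2_ball gamma (eps : R) : set (circle R -> 'rV[R]_2) := [set gamma' |
  forall k t, (k <= 2)%N ->
    enorm (dcurve gamma' k t - dcurve gamma k t) < eps].

(* Interior of A, relative to the set of tables, for the C^2 topology. *)
Definition C2_interior (A : set (circle R -> 'rV[R]_2)) :
    set (circle R -> 'rV[R]_2) := [set gamma |
  tables gamma /\
  exists2 eps : R, 0 < eps & tables `&` C2_ball gamma eps `<=` A].

End tables.

(* The billiard map is first defined on the universal cover R * R of the
   cylinder, whose points are the row vectors (t, s); there the cyclic
   condition t1 < t2 < t1^* becomes an inequality between real numbers, where
   t1^* is the representative lying in ]t1, t1 + 2 pi[. *)
Section billiard.
Variables (R : realType) (gamma : circle R -> 'rV[R]_2) (o : 'rV[R]_2).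

Local Notation cylinder := (circle R * R)%type.

Definition star (t : R) : R := get [set u |
  t < u < t + 2 * pi /\ det2 (dcurve gamma 1 t) (dcurve gamma 1 u) = 0].

Definition gen (t1 t2 : R) : R := det2 (lift_curve gamma t1 - o) (lift_curve gamma t2 - o).
Definition gen1 (t1 t2 : R) : R := derive1 (gen^~ t2) t1.
Definition gen2 (t1 t2 : R) : R := derive1 (gen t1) t2.

Definition mkpt (t s : R) : 'rV[R]_2 := \row_(i < 2) (if i == 0 then t else s).

Definition cover_phase : set 'rV[R]_2 := [set x |
  - gen1 (x 0 0) (star (x 0 0)) < x 0 1 < - gen1 (x 0 0) (x 0 0)].

Definition cover_map (x : 'rV[R]_2) : 'rV[R]_2 :=
  let t1 := x 0 0 in
  let t2 := get [set t2 | t1 < t2 < star t1 /\ x 0 1 = - gen1 t1 t2] in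
  mkpt t2 (gen2 t1 t2).

(* Inverse of the bijection that cover_map induces on cover_phase. *)
Definition cover_inv (y : 'rV[R]_2) : 'rV[R]_2 :=
  get [set x | cover_phase x /\ cover_map x = y].

Definition to_cylinder (x : 'rV[R]_2) : cylinder := (to_circle (x 0 0), x 0 1).
Definition of_cylinder (x : cylinder) : 'rV[R]_2 := mkpt (repr x.1) x.2.

Definition phase : set cylinder := to_cylinder @` cover_phase.

Definition billiard (x : cylinder) : cylinder :=
  to_cylinder (cover_map (of_cylinder x)).

(* Derivatives of the iterates, in the frame (d/dt, d/ds) of the tangent bundle
   of the cylinder. Jacobian matrices act on row vectors from the right. They
   do not depend on the representative in the cover, because cover_map and
   cover_inv commute with the translation (t, s) |-> (t + 2 pi, s). *)
Definition Dbilliard (n : nat) (x : cylinder) : 'M[R]_2 :=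
  'J (iter n cover_map) (of_cylinder x).
Definition Dbilliard_inv (n : nat) (x : cylinder) : 'M[R]_2 :=
  'J (iter n cover_inv) (of_cylinder x).

Definition least_period (n : nat) (x : cylinder) :=
  [/\ phase x, (0 < n)%N, iter n billiard x = x
    & forall k, (0 < k < n)%N -> iter k billiard x <> x].

Definition hyperbolic_mx (A : 'M[R]_2) :=
  forall z : R[i], eigenvalue (map_mx (real_complex R) A) z -> `|z| != 1.

Definition hyperbolic_periodic : set cylinder := [set x |
  exists2 n, least_period n x & hyperbolic_mx (Dbilliard n x)].

(* A family of subspaces, given as row spaces, is continuous when it is locally
   spanned by a continuous frame. *)
Definition continuous_subbundle (L : set cylinder) (E : cylinder -> 'M[R]_2) :=
  forall x, L x -> exists (U : set cylinder) (k : nat) (e : cylinder -> 'M[R]_(k, 2)),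
    [/\ nbhs x U, {within L `&` U, continuous e}
      & forall y, (L `&` U) y -> row_free (e y) /\ (e y == E y)%MS].

Definition hyperbolic_set (L : set cylinder) :=
  [/\ compact L, L `<=` phase, billiard @` L = L &
    exists (Es Eu : cylinder -> 'M[R]_2) (m : nat),
    [/\ continuous_subbundle L Es, continuous_subbundle L Eu
      & forall x, L x ->
        [/\ mxdirect (Es x + Eu x) /\ (Es x + Eu x == 1%:M)%MS,
            (Es x *m Dbilliard 1 x == Es (billiard x))%MS,
            (Eu x *m Dbilliard 1 x == Eu (billiard x))%MS,
            forall v : 'rV[R]_2, (v <= Es x)%MS ->
              enorm (v *m Dbilliard m x) <= 2^-1 * enorm v
          & forall v : 'rV[R]_2, (v <= Eu x)%MS ->
              enorm (v *m Dbilliard_inv m x) <= 2^-1 * enorm v]]].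

End billiard.

(* [origin] picks, for each table, the point O used in the coordinates. *)
Definition eventually_hyperbolic (R : realType)
    (origin : (circle R -> 'rV[R]_2) -> 'rV[R]_2) (p : nat) :
    set (circle R -> 'rV[R]_2) := [set gamma |
  tables gamma /\
  forall n x, (p <= n)%N -> least_period gamma (origin gamma) n x ->
    hyperbolic_periodic gamma (origin gamma) x].

(* Main.v *)
Require Import Defs.
From HB Require Import structures.
From mathcomp Require Import all_boot all_order all_algebra.
From mathcomp Require Import all_classical all_reals all_analysis.
From mathcomp Require Import complex zify ring lra.

Set Implicit Arguments.
Unset Strict Implicit.
Unset Printing Implicit Defensive.

Import Order.TTheory GRing.Theory Num.Theory.
Import numFieldNormedType.Exports.

Local Open Scope classical_set_scope.
Local Open Scope ring_scope.

(** The C^2-interior of the tables all of whose periodic points of period at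
    least p are hyperbolic is empty: every table can be approximated in the C^2
    topology by tables with a parabolic periodic point of arbitrarily large
    period.  The theorem therefore holds because no table satisfies its
    hypothesis ([C2_interior_empty]).

    The approximation.  Let f be a 2 pi-periodic curve, n a large integer,
    h = 2 pi / n, and let D g (t) = (g (t + h) - g (t - h)) / 2 h be the central
    difference.  Put U = D f - f' and W = D U - U', both O(h^2) with all their
    derivatives.  The curve
      F (t) = f (t) + sin (n t) / n . U (t) + (1 - cos (n t)) / n^2 . W (t)
    is C^2-close to f, since differentiating twice costs at most one factor
    n U = O(h) ([grid_interp_close]).  At the points t of the grid h Z it
    satisfies F = f, F' = D F and F'' = D F' ([grid_interp_on_grid]).

    The orbit.  The relation F' = D F says that the tangent at F (t) is parallel
    to the chord from F (t - h) to F (t + h), so the points of the grid form an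
    n-periodic billiard orbit ([cover_map_orbit]).  The relation F'' = D F' is
    the Jacobi equation
      b_{i-1} xi_{i-1} + a_i xi_i + b_i xi_{i+1} = 0,
      b_i = det (F'_i, F'_{i+1}),  a_i = det (F''_i, F_{i+1} - F_{i-1}),
    of that orbit for the constant field xi = 1.  Hence the tangent vector with
    dt = 1 carried by this field returns to itself after one period
    ([is_diff_orbit], [iter_cover_map]): the differential of the n-th iterate
    has the eigenvalue 1 and the orbit is not hyperbolic.

    Three further facts make this rigorous.  Tables are the curves with positive
    curvature lying strictly to the left of all their tangents
    ([table_oval], [oval_table]), a condition which is C^2-open ([oval_open]).
    On such a curve the tangent direction is opposite to the one at t exactly
    once per turn, which describes the phase space ([opposite_parameter]).  And
    the billiard map, which is defined by solving an equation, is differentiable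
    with the differential given by implicit differentiation
    ([is_diff_cover_map]). *)

Local Opaque derive1 sin cos.

(** * Smooth functions of one real variable *)

Section smooth_functions.
Variable R : realType.
Implicit Types f g : R -> R.

(** A one-constructor type, so that smoothness hypotheses stay folded. *)
Variant smoothf f : Prop :=
  Smoothf of forall n (t : R), derivable (derive1n n f) t 1.

Lemma derive1n_derive1 n f : derive1n n (derive1 f) = derive1n n.+1 f.
Proof. by rewrite derive1Sn. Qed.

Lemma smoothf_derive f : smoothf f -> smoothf (derive1 f).
Proof. by case=> sf; split=> n t; rewrite derive1n_derive1. Qed.

Lemma smoothf_derivable f (t : R) : smoothf f -> derivable f t 1.
Proof. by case=> /(_ 0%N t). Qed.

Lemma smoothf_is_derive f (t : R) : smoothf f -> is_derive t 1 f (derive1 f t).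
Proof. by move=> sf; rewrite derive1E; apply: derivableP; exact: smoothf_derivable. Qed.

Lemma smoothf_continuous f : smoothf f -> continuous f.
Proof.
move=> sf t; apply: differentiable_continuous.
by apply/derivable1_diffP; exact: smoothf_derivable.
Qed.

(** Differentiability by recursion on the order, where f itself varies: this is
    the form for which closure under products follows by induction, without
    Leibniz' formula. *)
Fixpoint nderivable n f : Prop :=
  (forall t : R, derivable f t 1) /\
  if n is n'.+1 then nderivable n' (derive1 f) else True.

Lemma smoothfP f : smoothf f <-> forall n, nderivable n f.
Proof.
split=> [sf n|nf].
  elim: n f sf => [|n IH] f sf /=; split=> //; try by move=> t; exact: smoothf_derivable.
  by apply: IH; exact: smoothf_derive.
split=> n t.
elim: n f nf => [|n IH] f nf; first by case: (nf 0%N).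
by rewrite -derive1n_derive1; apply: IH => m; case: (nf m.+1).
Qed.

Lemma nderivableW n f : nderivable n.+1 f -> nderivable n f.
Proof.
by elim: n f => [|n IH] f [df nf]; split=> //; apply: IH.
Qed.

Lemma is_derive_derive1 f (df : R -> R) : (forall t : R, is_derive t 1 f (df t)) -> derive1 f = df.
Proof.
by move=> Df; apply/funext => t; rewrite derive1E; apply: derive_val.
Qed.

Lemma is_derive1P f (t : R) : derivable f t 1 -> is_derive t 1 f (derive1 f t).
Proof. by move=> ?; rewrite derive1E; exact: derivableP. Qed.

Lemma nderivableD n f g : nderivable n f -> nderivable n g ->
  nderivable n (fun t => f t + g t).
Proof.
elim: n f g => [|n IH] f g [df nf] [dg ng].
  by split=> [t|//]; apply: derivableD.
split; first by move=> t; apply: derivableD.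
have -> : derive1 (fun t => f t + g t) = (fun t => derive1 f t + derive1 g t).
  apply: is_derive_derive1 => t; apply: is_deriveD; exact: is_derive1P.
exact: IH.
Qed.

Lemma nderivableM n f g : nderivable n f -> nderivable n g ->
  nderivable n (fun t => f t * g t).
Proof.
elim: n f g => [|n IH] f g [df nf] [dg ng].
  by split=> [t|//]; apply: derivableM.
split; first by move=> t; apply: derivableM.
have -> : derive1 (fun t => f t * g t) =
    (fun t => f t * derive1 g t + g t * derive1 f t).
  apply: is_derive_derive1 => t; apply: is_deriveM; exact: is_derive1P.
by apply: nderivableD; apply: IH => //; apply: nderivableW; split.
Qed.

Lemma smoothfD f g : smoothf f -> smoothf g -> smoothf (fun t => f t + g t).
Proof. by move=> /smoothfP nf /smoothfP ng; apply/smoothfP => n; exact: nderivableD. Qed.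

Lemma smoothfM f g : smoothf f -> smoothf g -> smoothf (fun t => f t * g t).
Proof. by move=> /smoothfP nf /smoothfP ng; apply/smoothfP => n; exact: nderivableM. Qed.

Lemma smoothf_cst (c : R) : smoothf (fun=> c).
Proof.
apply/smoothfP => n; elim: n c => [|n IH] c; first by split=> // t; exact: derivable_cst.
split; first by move=> t; exact: derivable_cst.
have -> : derive1 (fun _ : R => c) = (fun=> 0) by apply: is_derive_derive1.
exact: IH.
Qed.

Lemma smoothfN f : smoothf f -> smoothf (fun t => - f t).
Proof.
move=> sf; rewrite (_ : (fun t => _) = (fun t => -1 * f t)).
  by apply: smoothfM => //; exact: smoothf_cst.
by apply/funext => t; rewrite mulN1r.
Qed.

Lemma smoothfB f g : smoothf f -> smoothf g -> smoothf (fun t => f t - g t).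
Proof. by move=> sf sg; apply: smoothfD => //; exact: smoothfN. Qed.

Lemma smoothf_shift f c : smoothf f -> smoothf (fun t => f (t + c)).
Proof.
move=> /smoothfP nf; apply/smoothfP => n; move: {nf}(nf n).
have D g (t : R) : derivable g (t + c) 1 ->
    is_derive t 1 (fun t => g (t + c)) (derive1 g (t + c)).
  move=> dg; have := @is_derive1_comp _ g (fun t : R => t + c) t _ _ (is_derive1P dg).
  move/(_ 1); rewrite mulr1; apply.
  by apply: is_derive_eq; rewrite addr0.
elim: n f => [|n IH] f [df nf].
  by split=> [t|//]; case: (D f t (df _)).
split; first by move=> t; case: (D f t (df _)).
have -> : derive1 (fun t => f (t + c)) = (fun t => derive1 f (t + c)).
  by apply: is_derive_derive1 => t; apply: D.
exact: IH.
Qed.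

Lemma is_derive_scaled (f : R -> R) (c t d : R) : is_derive (c * t) 1 f d ->
  is_derive t 1 (fun t => f (c * t)) (c * d).
Proof.
move=> Df; rewrite mulrC.
apply: (@is_derive1_comp _ f (fun t : R => c * t)).
by apply: is_derive_eq; rewrite [LHS]mulr1.
Qed.

(** Each function is, up to a constant, the derivative of the other, so the two
    statements are proved by a single induction. *)
Lemma smoothf_sincos (c : R) :
  smoothf (fun t => sin (c * t)) /\ smoothf (fun t => cos (c * t)).
Proof.
suff H n : nderivable n (fun t : R => sin (c * t)) /\ nderivable n (fun t : R => cos (c * t)).
  by split; apply/smoothfP => n; case: (H n).
have Ds (t : R) : is_derive t 1 (fun t => sin (c * t)) (c * cos (c * t)).
  exact: is_derive_scaled.
have Dc (t : R) : is_derive t 1 (fun t => cos (c * t)) (c * - sin (c * t)).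
  exact: is_derive_scaled.
have nc a m : nderivable m (fun=> a) by move: m; apply/smoothfP; exact: smoothf_cst.
elim: n => [|n [IHs IHc]]; first by split; split=> // t.
split; split=> //.
  have -> : derive1 (fun t : R => sin (c * t)) = (fun t => c * cos (c * t)).
    exact: is_derive_derive1.
  exact: nderivableM.
have -> : derive1 (fun t : R => cos (c * t)) = (fun t => (- c) * sin (c * t)).
  by apply: is_derive_derive1 => t; apply: is_derive_eq; rewrite mulrN mulNr.
exact: nderivableM.
Qed.

End smooth_functions.

(** * Mean values and periodic functions *)

Section periodic_functions.
Variable R : realType.
Implicit Types f g : R -> R.

Lemma is_derive_affine f (df : R -> R) (c a t : R) :
  (forall x : R, is_derive x 1 f (df x)) ->
  is_derive t 1 (fun x => f (c + a * x)) (a * df (c + a * t)).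
Proof.
move=> Df; rewrite mulrC.
apply: (@is_derive1_comp _ f (fun t : R => c + a * t)).
by apply: is_derive_eq; rewrite /GRing.scale /=; ring.
Qed.

(** The mean value theorem with the intermediate point written as a fraction of
    the displacement, which treats u < t, u = t and u > t uniformly. *)
Lemma mean_value f (df : R -> R) (t u : R) :
  (forall x : R, is_derive x 1 f (df x)) ->
  exists2 th : R, 0 < th < 1 & f u - f t = df (t + th * (u - t)) * (u - t).
Proof.
move=> Df.
have D' (x : R) : is_derive x 1 (fun x => f (t + (u - t) * x)) ((u - t) * df (t + (u - t) * x)).
  exact: is_derive_affine.
have [|th] := @MVT R (fun x => f (t + (u - t) * x))
    (fun x => (u - t) * df (t + (u - t) * x)) 0 1 ltr01 (fun x _ => D' x).
  apply: derivable_within_continuous => x _; exact: ex_derive.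
rewrite in_itv /= => th01; rewrite mulr1 mulr0 addr0 subr0 mulr1 subrKC => E.
by exists th; rewrite // E mulrC (mulrC th).
Qed.

Lemma derive_bound_lipschitz f (df : R -> R) (M t u : R) :
  (forall x : R, is_derive x 1 f (df x)) -> (forall x, `|df x| <= M) ->
  `|f u - f t| <= M * `|u - t|.
Proof.
move=> Df dfM; have [th _ ->] := mean_value t u Df.
by rewrite normrM ler_wpM2r.
Qed.

Lemma periodic_int f (T t : R) (k : int) : periodic f T -> f (t + k%:~R * T) = f t.
Proof.
move=> pf; case: k => k; first by rewrite -pmulrn mulr_natl periodicn.
rewrite NegzE mulrNz mulNr -pmulrn mulr_natl.
by rewrite -[LHS](periodicn pf k.+1) subrK.
Qed.

Lemma reduce_mod (T t : R) : 0 < T -> exists k : int, 0 <= t + k%:~R * T < T.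
Proof.
move=> T0; exists (- Num.floor (t / T)); rewrite mulrNz mulNr.
have /andP[h1 h2] := real_floor_itv (num_real (t / T)).
rewrite subr_ge0 -ler_pdivlMr// h1 /= ltrBlDr.
by move: h2; rewrite intrD ltr_pdivrMr// mulrDl mul1r addrC.
Qed.

Lemma periodic_derive1 f (T : R) : smoothf f -> periodic f T -> periodic (derive1 f) T.
Proof.
move=> sf pf t.
have E : derive1 (fun t => f (t + T)) = (fun t => derive1 f (t + T)).
  apply: is_derive_derive1 => x; rewrite -[X in is_derive _ _ _ X]mulr1.
  apply: (@is_derive1_comp _ f (fun t : R => t + T)); first exact: smoothf_is_derive.
  by apply: is_derive_eq; rewrite addr0.
by rewrite -[LHS]/((fun t => derive1 f (t + T)) t) -E; congr (derive1 _ t); apply/funext.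
Qed.

Lemma twopi_gt0 : 0 < 2 * pi :> R.
Proof. by rewrite mulr_gt0 ?ltr0n// pi_gt0. Qed.

Lemma periodic_bounded f (T : R) : 0 < T -> continuous f -> periodic f T ->
  exists2 M : R, 0 < M & forall t, `|f t| <= M.
Proof.
move=> T0 cf pf.
have [c _ Hc] : exists2 c, c \in `[0, T] & forall t, t \in `[0, T] -> `|f t| <= `|f c|.
  apply: (@EVT_max R (fun t => `|f t|)); first exact: ltW.
  by apply: continuous_subspaceT => x; apply: continuous_comp; [exact: cf|exact: norm_continuous].
exists (`|f c| + 1); first by rewrite ltr_pwDr.
move=> t; have [k /andP[k0 kT]] := reduce_mod t T0.
rewrite -(periodic_int t k pf); apply: le_trans (_ : `|f c| <= _); last by rewrite lerDl.
by apply: Hc; rewrite in_itv /= k0 ltW.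
Qed.

Lemma smoothf_derive1n n f : smoothf f -> smoothf (derive1n n f).
Proof. by move=> sf; elim: n => // n IH; rewrite derive1nS; exact: smoothf_derive. Qed.

Lemma periodic_derive1n n f (T : R) : smoothf f -> periodic f T ->
  periodic (derive1n n f) T.
Proof.
move=> sf pf; elim: n => // n IH; rewrite derive1nS.
by apply: periodic_derive1 => //; exact: smoothf_derive1n.
Qed.

(** A single bound for finitely many derivatives, from compactness of a
    period. *)
Lemma smooth_periodic_bounded f (T : R) n : 0 < T -> smoothf f -> periodic f T ->
  exists2 M : R, 0 < M & forall k t, (k <= n)%N -> `|derive1n k f t| <= M.
Proof.
move=> T0 sf pf; elim: n => [|n [M M0 HM]].
  have [M M0 HM] := periodic_bounded T0 (smoothf_continuous sf) pf.
  by exists M => // k t; rewrite leqn0 => /eqP ->; exact: HM.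
have [M' M'0 HM'] := periodic_bounded T0
  (smoothf_continuous (@smoothf_derive1n n.+1 f sf)) (@periodic_derive1n n.+1 f T sf pf).
exists (M + M'); first exact: addr_gt0.
move=> k t; rewrite leq_eqVlt => /orP[/eqP ->|].
  by apply: le_trans (HM' t) _; rewrite lerDr ltW.
by rewrite ltnS => kn; apply: le_trans (HM _ t kn) _; rewrite lerDl ltW.
Qed.

End periodic_functions.

(** * Central differences *)

Section central_difference.
Variable R : realType.
Implicit Types f g : R -> R.

Definition cdiff (h : R) f (t : R) : R := (f (t + h) - f (t - h)) / (2 * h).

Lemma smoothf_cdiff h f : smoothf f -> smoothf (cdiff h f).
Proof.
move=> sf; apply: smoothfM; last exact: smoothf_cst.
by apply: smoothfB; apply: smoothf_shift.
Qed.

Lemma periodic_cdiff h f (T : R) : periodic f T -> periodic (cdiff h f) T.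
Proof. by move=> pf t; rewrite /cdiff !(addrAC t T) !pf. Qed.

Lemma is_derive_cdiff h f (t : R) : smoothf f ->
  is_derive t 1 (cdiff h f) (cdiff h (derive1 f) t).
Proof.
move=> sf.
have D c : is_derive t 1 (fun x => f (x + c)) (derive1 f (t + c)).
  rewrite -[X in is_derive _ _ _ X]mulr1.
  apply: (@is_derive1_comp _ f (fun t : R => t + c)); first exact: smoothf_is_derive.
  by apply: is_derive_eq; rewrite addr0.
have -> : cdiff h f = (2 * h)^-1 *: ((fun x => f (x + h)) - (fun x => f (x - h))).
  by apply/funext => x; rewrite /cdiff mulrC.
have -> : cdiff h (derive1 f) t = (2 * h)^-1 *: (derive1 f (t + h) - derive1 f (t - h)).
  by rewrite /cdiff mulrC.
exact: (is_deriveZ _ (is_deriveB (D h) (D (- h)))).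
Qed.

(** The central difference is a value of the derivative, by the mean value
    theorem. *)
Lemma cdiff_le h f (M t : R) : 0 < h -> smoothf f ->
  (forall x, `|derive1 f x| <= M) -> `|cdiff h f t| <= M.
Proof.
move=> h0 sf fM; rewrite /cdiff normrM normfV (@gtr0_norm _ (2 * h)) ?mulr_gt0//.
rewrite ler_pdivrMr ?mulr_gt0//.
apply: le_trans (derive_bound_lipschitz _ _ (fun x => smoothf_is_derive x sf) fM) _.
have -> : t + h - (t - h) = 2 * h by ring.
by rewrite gtr0_norm ?mulr_gt0.
Qed.

(** The symmetry of the difference quotient makes the second-order term of the
    Taylor expansion cancel, whence the factor h^2; an error of order h only
    would not suffice to make the perturbation C^2-small. *)
Lemma cdiff_sub_derive h f (M t : R) : 0 < h -> smoothf f ->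
  (forall x, `|derive1n 3 f x| <= M) -> `|cdiff h f t - derive1 f t| <= h ^+ 2 * M.
Proof.
move=> h0 sf fM.
have M0 : 0 <= M by apply: le_trans (fM 0).
pose f1 := derive1 f; pose f2 := derive1 f1.
have D0 (x : R) : is_derive x 1 f (f1 x) by exact: smoothf_is_derive.
have D1 (x : R) : is_derive x 1 f1 (f2 x).
  by apply: smoothf_is_derive; exact: smoothf_derive.
have D2 (x : R) : is_derive x 1 f2 (derive1n 3 f x).
  by apply: (@smoothf_is_derive _ f2); do 2!apply: smoothf_derive.
pose phi x := f (t + 1 * x) - f (t + -1 * x) - (2 * f1 t) * x.
pose chi x := f1 (t + 1 * x) + f1 (t + -1 * x) - 2 * f1 t.
have Dphi (x : R) : is_derive x 1 phi (chi x).
  have := is_deriveB (is_deriveB (is_derive_affine t 1 x D0) (is_derive_affine t (-1) x D0))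
    (is_deriveZ (2 * f1 t) (is_derive_id x (1 : R))).
  by move=> H; apply: (is_derive_eq H); rewrite /chi /GRing.scale /=; ring.
have Dchi (x : R) : is_derive x 1 chi (f2 (t + 1 * x) - f2 (t + -1 * x)).
  have := is_deriveB (is_deriveD (is_derive_affine t 1 x D1) (is_derive_affine t (-1) x D1))
    (is_derive_cst (2 * f1 t) x (1 : R)).
  move=> H; apply: (is_derive_eq H); rewrite subr0.
  by congr (_ + _); [exact: mul1r|exact: mulN1r].
have [a /andP[a0 a1]] := mean_value 0 h Dphi.
have [b /andP[b0 b1]] := mean_value 0 (a * h) Dchi.
rewrite !subr0 !add0r => Hchi Hphi.
have phi0 : phi 0 = 0 by rewrite /phi !mulr0 addr0 !subrr.
have chi0 : chi 0 = 0 by rewrite /chi !mulr0 addr0; ring.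
move: Hchi Hphi; rewrite phi0 chi0 !subr0 => Hchi Hphi.
have bd : `|phi h| <= 2 * h ^+ 3 * M.
  rewrite Hphi Hchi normrM (gtr0_norm h0) normrM.
  have ha : `|a * h| <= h.
    by rewrite normrM !gtr0_norm// ger_pMl// ltW.
  have := derive_bound_lipschitz (t + -1 * (b * (a * h))) (t + 1 * (b * (a * h))) D2 fM.
  rewrite !mul1r !mulN1r => Hf.
  have hb : `|t + b * (a * h) - (t - b * (a * h))| <= 2 * h.
    have -> : t + b * (a * h) - (t - b * (a * h)) = 2 * (b * (a * h)) by ring.
    rewrite normrM ger0_norm// ler_pM2l// normrM -[leRHS]mul1r.
    by rewrite ler_pM// gtr0_norm// ltW.
  have {}Hf := le_trans Hf (ler_wpM2l M0 hb).
  have -> : 2 * h ^+ 3 * M = M * (2 * h) * h * h by ring.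
  by rewrite (ler_wpM2r (ltW h0))// ler_pM.
have -> : cdiff h f t - f1 t = phi h / (2 * h).
  rewrite /cdiff /phi mul1r mulN1r; field; rewrite gt_eqF//.
rewrite normrM normfV (@gtr0_norm _ (2 * h)) ?mulr_gt0// ler_pdivrMr ?mulr_gt0//.
by apply: le_trans bd _; rewrite le_eqVlt; apply/orP; left; apply/eqP; ring.
Qed.

End central_difference.

(** * A perturbation with prescribed first and second derivatives on a grid *)

Section grid_interpolation.
Variable R : realType.
Implicit Types f g : R -> R.

Definition step (n : nat) : R := 2 * pi / n%:R.

(** The grid is the preimage of a regular subdivision of the circle into n
    arcs; it consists of the common zeros of sin (n t) and 1 - cos (n t). *)
Definition on_grid (n : nat) (t : R) := exists k : int, t = k%:~R * step n.

Definition cdiff_err h f (t : R) : R := cdiff h f t - derive1 f t.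

(** With this choice the second derivative of the interpolant below, which is
    f'' + 2 (D f - f')' + W on the grid, becomes the iterated central difference
    D (D f). *)
Definition cdiff2_err h f (t : R) : R :=
  cdiff h (cdiff_err h f) t - cdiff_err h (derive1 f) t.

(** The factor sin (n t) / n vanishes on the grid with derivative 1, and
    (1 - cos (n t)) / n^2 vanishes there to second order with second derivative
    1: they prescribe the first and the second derivative independently. *)
Definition grid_interp n f (t : R) : R :=
  f t + n%:R^-1 * sin (n%:R * t) * cdiff_err (step n) f t
  + n%:R^-1 ^+ 2 * (1 - cos (n%:R * t)) * cdiff2_err (step n) f t.

Lemma smoothf_cdiff_err h f : smoothf f -> smoothf (cdiff_err h f).
Proof.
by move=> sf; apply: smoothfB; [exact: smoothf_cdiff|exact: smoothf_derive].
Qed.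

Lemma smoothf_cdiff2_err h f : smoothf f -> smoothf (cdiff2_err h f).
Proof.
move=> sf; apply: smoothfB; first by apply: smoothf_cdiff; exact: smoothf_cdiff_err.
by apply: smoothf_cdiff_err; exact: smoothf_derive.
Qed.

Lemma is_derive_cdiff_err h f (t : R) : smoothf f ->
  is_derive t 1 (cdiff_err h f) (cdiff_err h (derive1 f) t).
Proof.
move=> sf; apply: is_deriveB; first exact: is_derive_cdiff.
by apply: smoothf_is_derive; exact: smoothf_derive.
Qed.

Lemma derive1_cdiff_err h f : smoothf f ->
  derive1 (cdiff_err h f) = cdiff_err h (derive1 f).
Proof. by move=> sf; apply: is_derive_derive1 => t; exact: is_derive_cdiff_err. Qed.

Lemma is_derive_cdiff2_err h f (t : R) : smoothf f ->
  is_derive t 1 (cdiff2_err h f) (cdiff2_err h (derive1 f) t).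
Proof.
move=> sf; apply: is_deriveB; last by apply: is_derive_cdiff_err; exact: smoothf_derive.
have := is_derive_cdiff h t (smoothf_cdiff_err h sf).
by rewrite (derive1_cdiff_err h sf).
Qed.

Lemma smoothf_grid_interp n f : smoothf f -> smoothf (grid_interp n f).
Proof.
move=> sf; have [ss sc] := smoothf_sincos (n%:R : R).
apply: smoothfD; [apply: smoothfD => //|]; apply: smoothfM.
- by apply: smoothfM => //; exact: smoothf_cst.
- exact: smoothf_cdiff_err.
- by apply: smoothfM; [exact: smoothf_cst|apply: smoothfB => //; exact: smoothf_cst].
- exact: smoothf_cdiff2_err.
Qed.

Lemma periodic_grid_interp n f : smoothf f -> periodic f (2 * pi) ->
  periodic (grid_interp n f) (2 * pi).
Proof.
move=> sf pf t.
have pe g : smoothf g -> periodic g (2 * pi) -> periodic (cdiff_err (step n) g) (2 * pi).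
  move=> sg pg x; rewrite /cdiff_err (periodic_cdiff _ pg).
  by rewrite (periodic_derive1 sg pg).
have e2pi x : x + n%:R * (2 * pi) = x + (pi *+ 2) *+ n :> R.
  by congr (_ + _); rewrite -[RHS]mulr_natl -[pi *+ 2]mulr_natl.
rewrite /grid_interp [n%:R * (t + _)]mulrDr e2pi (periodicn (@sinD2pi R)) (periodicn (@cosD2pi R)).
rewrite pf (pe _ sf pf) /cdiff2_err (periodic_cdiff _ (pe _ sf pf)).
by rewrite (pe _ (smoothf_derive sf) (periodic_derive1 sf pf)).
Qed.

Lemma derive1_grid_interp n f : (0 < n)%N -> smoothf f ->
  derive1 (grid_interp n f) = fun t =>
  derive1 f t + cos (n%:R * t) * cdiff_err (step n) f t
  + n%:R^-1 * sin (n%:R * t) * (cdiff_err (step n) (derive1 f) t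
                                 + cdiff2_err (step n) f t)
  + n%:R^-1 ^+ 2 * (1 - cos (n%:R * t)) * cdiff2_err (step n) (derive1 f) t.
Proof.
move=> n0 sf; apply: is_derive_derive1 => t.
have D0 := smoothf_is_derive t sf.
have DU := is_derive_cdiff_err (step n) t sf.
have DW := is_derive_cdiff2_err (step n) t sf.
have Ds : is_derive t 1 (fun t : R => sin (n%:R * t)) (n%:R * cos (n%:R * t)).
  exact: is_derive_scaled.
have Dc : is_derive t 1 (fun t : R => cos (n%:R * t)) (n%:R * - sin (n%:R * t)).
  exact: is_derive_scaled.
have D1 := is_deriveM (is_deriveM (is_derive_cst (n%:R^-1 : R) t (1 : R)) Ds) DU.
have D2 := is_deriveM (is_deriveM (is_derive_cst (n%:R^-1 ^+ 2: R) t (1 : R))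
  (is_deriveB (is_derive_cst (1 : R) t (1 : R)) Dc)) DW.
apply: (is_derive_eq (is_deriveD (is_deriveD D0 D1) D2)).
have alg (N f' s c U U' W W' : R) : N != 0 ->
    f' + (N^-1 * s * U' + U * (N^-1 * (N * c) + s * 0))
    + (N^-1 ^+ 2 * (1 - c) * W' + W * (N^-1 ^+ 2 * (0 - N * - s) + (1 - c) * 0))
    = f' + c * U + N^-1 * s * (U' + W) + N^-1 ^+ 2 * (1 - c) * W'.
  by move=> ?; field.
by apply: alg; rewrite pnatr_eq0 -lt0n.
Qed.

Lemma derive2_grid_interp n f : (0 < n)%N -> smoothf f ->
  derive1 (derive1 (grid_interp n f)) = fun t =>
  derive1 (derive1 f) t
  + cos (n%:R * t) * (cdiff_err (step n) (derive1 f) t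
                      + cdiff_err (step n) (derive1 f) t
                      + cdiff2_err (step n) f t)
  - n%:R * sin (n%:R * t) * cdiff_err (step n) f t
  + n%:R^-1 * sin (n%:R * t) * (cdiff_err (step n) (derive1 (derive1 f)) t
                                 + cdiff2_err (step n) (derive1 f) t
                                 + cdiff2_err (step n) (derive1 f) t)
  + n%:R^-1 ^+ 2 * (1 - cos (n%:R * t)) * cdiff2_err (step n) (derive1 (derive1 f)) t.
Proof.
move=> n0 sf; have sf' := smoothf_derive sf; have sf'' := smoothf_derive sf'.
rewrite derive1_grid_interp//; apply: is_derive_derive1 => t.
have D0 := smoothf_is_derive t sf'.
have DU := is_derive_cdiff_err (step n) t sf.
have DU' := is_derive_cdiff_err (step n) t sf'.
have DW := is_derive_cdiff2_err (step n) t sf.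
have DW' := is_derive_cdiff2_err (step n) t sf'.
have Ds : is_derive t 1 (fun t : R => sin (n%:R * t)) (n%:R * cos (n%:R * t)).
  exact: is_derive_scaled.
have Dc : is_derive t 1 (fun t : R => cos (n%:R * t)) (n%:R * - sin (n%:R * t)).
  exact: is_derive_scaled.
have D1 := is_deriveM Dc DU.
have D2 := is_deriveM (is_deriveM (is_derive_cst (n%:R^-1 : R) t (1 : R)) Ds)
  (is_deriveD DU' DW).
have D3 := is_deriveM (is_deriveM (is_derive_cst (n%:R^-1 ^+ 2: R) t (1 : R))
  (is_deriveB (is_derive_cst (1 : R) t (1 : R)) Dc)) DW'.
apply: (is_derive_eq (is_deriveD (is_deriveD (is_deriveD D0 D1) D2) D3)).
have alg (N f' s c U U' U'' W W' W'' : R) : N != 0 ->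
    f' + (c * U' + U * (N * - s))
    + (N^-1 * s * (U'' + W') + (U' + W) * (N^-1 * (N * c) + s * 0))
    + (N^-1 ^+ 2 * (1 - c) * W'' + W' * (N^-1 ^+ 2 * (0 - N * - s) + (1 - c) * 0))
    = f' + c * (U' + U' + W) - N * s * U + N^-1 * s * (U'' + W' + W')
      + N^-1 ^+ 2 * (1 - c) * W''.
  by move=> ?; field.
by apply: alg; rewrite pnatr_eq0 -lt0n.
Qed.

Lemma on_gridP n t : (0 < n)%N -> on_grid n t ->
  sin (n%:R * t) = 0 /\ cos (n%:R * t) = 1.
Proof.
move=> n0 [k ->]; have nz : n%:R != 0 :> R by rewrite pnatr_eq0 -lt0n.
have -> : n%:R * (k%:~R * step n) = 0 + k%:~R * (pi *+ 2).
  by rewrite /step -[pi *+ 2]mulr_natl; field.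
by rewrite (periodic_int _ _ (@sinD2pi R)) (periodic_int _ _ (@cosD2pi R)) sin0 cos0.
Qed.

Lemma on_grid_step n t : on_grid n t -> on_grid n (t + step n) /\ on_grid n (t - step n).
Proof.
move=> [k ->]; split; [exists (k + 1)|exists (k - 1)].
  by rewrite intrD mulrDl mul1r.
by rewrite intrB mulrBl mul1r.
Qed.

(** On the grid the interpolant takes the values of f and its derivative the
    values of D f; as the neighbours t + h and t - h are again on the grid, the
    central differences may be computed with the interpolant itself. *)
Lemma grid_interp_on_grid n f t : (0 < n)%N -> smoothf f -> on_grid n t ->
  derive1 (grid_interp n f) t = cdiff (step n) (grid_interp n f) t /\
  derive1 (derive1 (grid_interp n f)) t = cdiff (step n) (derive1 (grid_interp n f)) t.
Proof.
move=> n0 sf gt.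
have v0 x : on_grid n x -> grid_interp n f x = f x.
  move=> /(on_gridP n0)[s c]; by rewrite /grid_interp s c subrr !mulr0 !mul0r !addr0.
have v1 x : on_grid n x -> derive1 (grid_interp n f) x = cdiff (step n) f x.
  move=> /(on_gridP n0)[s c]; rewrite (derive1_grid_interp n0 sf) s c.
  by rewrite subrr !mulr0 !mul0r !addr0 mul1r /cdiff_err subrKC.
have [gp gm] := on_grid_step gt.
split; first by rewrite (v1 t gt) /cdiff (v0 _ gp) (v0 _ gm).
have -> : cdiff (step n) (derive1 (grid_interp n f)) t =
    cdiff (step n) (cdiff (step n) f) t.
  by rewrite {1}/cdiff (v1 _ gp) (v1 _ gm).
have [s c] := on_gridP n0 gt.
rewrite (derive2_grid_interp n0 sf) s c.
rewrite subrr !mulr0 !mul0r !addr0 mul1r subr0.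
rewrite /cdiff2_err.
have -> : cdiff (step n) (cdiff_err (step n) f) t =
    cdiff (step n) (cdiff (step n) f) t - cdiff (step n) (derive1 f) t.
  have alg (x y z w d : R) : (x - y - (z - w)) / d = (x - z) / d - (y - w) / d.
    by ring.
  exact: alg.
have alg (f2 x y : R) : f2 + (x - f2 + (x - f2) + (y - x - (x - f2))) = y by ring.
exact: alg.
Qed.

Lemma cdiff_err_le h f (M t : R) : 0 < h -> smoothf f ->
  (forall x, `|derive1n 3 f x| <= M) -> `|cdiff_err h f t| <= h ^+ 2 * M.
Proof. exact: cdiff_sub_derive. Qed.

Lemma cdiff2_err_le h f (M t : R) : 0 < h -> smoothf f ->
  (forall x, `|derive1n 4 f x| <= M) -> `|cdiff2_err h f t| <= 2 * (h ^+ 2 * M).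
Proof.
move=> h0 sf fM; have sf' := smoothf_derive sf.
have b x : `|cdiff_err h (derive1 f) x| <= h ^+ 2 * M.
  by apply: cdiff_err_le => // y; rewrite derive1n_derive1.
rewrite (le_trans (ler_normB _ _))// mulr_natl mulr2n lerD//.
apply: cdiff_le => //; first exact: smoothf_cdiff_err.
by move=> x; rewrite derive1_cdiff_err.
Qed.

Lemma norm_sin_le1 (x : R) : `|sin x| <= 1.
Proof. by rewrite ler_norml sin_geN1 sin_le1. Qed.

Lemma norm_cos_le1 (x : R) : `|cos x| <= 1.
Proof. by rewrite ler_norml cos_geN1 cos_le1. Qed.

(** The largest contribution is n sin (n t) U, of order n h^2 = 2 pi h, in the
    second derivative. *)
Lemma grid_interp_close f (e : R) : 0 < e -> smoothf f -> periodic f (2 * pi) ->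
  exists n0, forall n, (n0 <= n)%N -> (0 < n)%N -> forall k t, (k <= 2)%N ->
    `|derive1n k (grid_interp n f) t - derive1n k f t| < e.
Proof.
have est0 (y x1 x2 B C : R) : 0 < B -> B <= C -> `|x1| <= 1 * B ->
    `|x2| <= 2 * (2 * B) -> `|y + x1 + x2 - y| <= 14 * C.
  by rewrite !ler_norml => ? ? /andP[? ?] /andP[? ?]; apply/andP; split; lra.
have est1 (y x0 x1 x2 B C : R) : 0 < B -> B <= C -> `|x0| <= 1 * B ->
    `|x1| <= 1 * (B + 2 * B) -> `|x2| <= 2 * (2 * B) ->
    `|y + x0 + x1 + x2 - y| <= 14 * C.
  rewrite !ler_norml => ? ? /andP[? ?] /andP[? ?] /andP[? ?].
  by apply/andP; split; lra.
have est2 (y x0 x1 x2 x3 B C : R) : 0 < B -> B <= C ->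
    `|x0| <= 1 * (B + B + 2 * B) -> `|x1| <= 1 * (B + 2 * B + 2 * B) ->
    `|x2| <= 2 * (2 * B) -> `|x3| <= C ->
    `|y + x0 - x3 + x1 + x2 - y| <= 14 * C.
  rewrite !ler_norml => ? ? /andP[? ?] /andP[? ?] /andP[? ?] /andP[? ?].
  by apply/andP; split; lra.
move=> e0 sf pf.
have [M M0 HM] := smooth_periodic_bounded 6 (twopi_gt0 R) sf pf.
(* every term is at most a multiple of n h^2 M = (2 pi)^2 M / n, and the factors
   add up to at most 14 *)
pose C : R := 14 * ((2 * pi) ^+ 2 * M).
have C0 : 0 < C by rewrite mulr_gt0// mulr_gt0// exprn_gt0// twopi_gt0.
exists (Num.truncn (C / e)).+1 => n n_big n0 k t k2.
have N1 : 1 <= n%:R :> R by rewrite ler1n.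
have N0 : 0 < n%:R :> R by rewrite ltr0n.
have NC : C / n%:R < e.
  rewrite ltr_pdivrMr// mulrC -ltr_pdivrMr//.
  by apply: lt_le_trans (_ : (Num.truncn (C / e)).+1%:R <= _); [exact: truncnS_gt|rewrite ler_nat].
pose h := step n; have h0 : 0 < h by rewrite divr_gt0// twopi_gt0.
pose B := h ^+ 2 * M; have B0 : 0 < B by rewrite mulr_gt0// exprn_gt0.
have NB : n%:R * B = (2 * pi) ^+ 2 * M / n%:R.
  by rewrite /B /h /step; field; rewrite gt_eqF.
have BNB : B <= n%:R * B by rewrite ler_peMl// ltW.
have small : 14 * (n%:R * B) < e by rewrite NB mulrA; exact: NC.
have iN1 : n%:R^-1 <= 1 :> R by rewrite invf_le1.
have iN0 : 0 < n%:R^-1 :> R by rewrite invr_gt0.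
have sfk j : smoothf (derive1n j f) by exact: smoothf_derive1n.
have U j : (j <= 3)%N -> `|cdiff_err h (derive1n j f) t| <= B.
  move=> j3; apply: cdiff_err_le => // x.
  by rewrite -[derive1n 3 _]iterD -[iter _ _ _]/(derive1n (3 + j) f); exact: HM.
have W j : (j <= 2)%N -> `|cdiff2_err h (derive1n j f) t| <= 2 * B.
  move=> j2; apply: cdiff2_err_le => // x.
  by rewrite -[derive1n 4 _]iterD -[iter _ _ _]/(derive1n (4 + j) f); exact: HM.
have U0 := U 0%N isT; have U1 := U 1%N isT; have U2 := U 2%N isT.
have W0 := W 0%N isT; have W1 := W 1%N isT; have W2 := W 2%N isT.
rewrite /derive1n /= in U0 U1 U2 W0 W1 W2.
set s := sin (n%:R * t); set c := cos (n%:R * t).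
have s1 : `|s| <= 1 by exact: norm_sin_le1.
have c1 : `|c| <= 1 by exact: norm_cos_le1.
have is1 : `|n%:R^-1 * s| <= 1 by rewrite normrM gtr0_norm// mulr_ile1// ltW.
have ic2 : `|n%:R^-1 ^+ 2 * (1 - c)| <= 2.
  have i0 : 0 < (n%:R^-1 : R) ^+ 2 by exact: exprn_gt0.
  have i1 : (n%:R^-1 : R) ^+ 2 <= 1 by rewrite exprn_ile1// ltW.
  rewrite normrM (gtr0_norm i0) -[leRHS]mul1r ler_pM// ?(ltW i0)//.
  by rewrite (le_trans (ler_normB _ _))// normr1 [leRHS]mulr2n lerD2l.
have prod (a x p q : R) : `|a| <= p -> `|x| <= q -> `|a * x| <= p * q.
  by move=> ? ?; rewrite normrM ler_pM.
apply: le_lt_trans small.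
case: k k2 => [|[|[|//]]] _; rewrite /derive1n /=.
- have T1 := prod _ _ _ _ is1 U0.
  have T2 := prod _ _ _ _ ic2 W0.
  exact: est0 B0 BNB T1 T2.
- have T0 := prod _ _ _ _ c1 U0.
  have T1 := prod _ _ _ _ is1 (le_trans (ler_normD _ _) (lerD U1 W0)).
  have T2 := prod _ _ _ _ ic2 W1.
  rewrite (derive1_grid_interp n0 sf); exact: est1 B0 BNB T0 T1 T2.
- have T0 := prod _ _ _ _ c1 (le_trans (ler_normD _ _)
    (lerD (le_trans (ler_normD _ _) (lerD U1 U1)) W0)).
  have T1 := prod _ _ _ _ is1 (le_trans (ler_normD _ _)
    (lerD (le_trans (ler_normD _ _) (lerD U2 W1)) W1)).
  have T2 := prod _ _ _ _ ic2 W2.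
  have ns1 : `|n%:R * s| <= n%:R by rewrite normrM gtr0_norm// ler_piMr// ltW.
  have T3 := prod _ _ _ _ ns1 U0.
  rewrite (derive2_grid_interp n0 sf); exact: est2 B0 BNB T0 T1 T2 T3.
Qed.

End grid_interpolation.

(** * Strictly convex curves and their stability *)

Section ovals.
Variable R : realType.
Implicit Types a b : R -> R.

(** Up to the speed at t, the signed distance of the point of parameter u to the
    tangent at t, counted positively on the left. *)
Definition tangent_height a b (t u : R) : R :=
  derive1 a t * (b u - b t) - derive1 b t * (a u - a t).

Definition tangent_det a b (t u : R) : R :=
  derive1 a t * derive1 b u - derive1 b t * derive1 a u.

Definition bending a b (t u : R) : R :=
  derive1 a t * derive1 (derive1 b) u - derive1 b t * derive1 (derive1 a) u.

(** Strict convexity in a form without reference to the convex hull: positive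
    curvature, and the curve lies strictly to the left of each of its
    tangents. *)
Definition oval a b := [/\ smoothf a, smoothf b,
  periodic a (2 * pi) /\ periodic b (2 * pi),
  forall t, 0 < bending a b t t
  & forall t u, t < u < t + 2 * pi -> 0 < tangent_height a b t u].

Lemma is_derive_tangent_height a b (t u : R) : smoothf a -> smoothf b ->
  is_derive u 1 (tangent_height a b t) (tangent_det a b t u).
Proof.
move=> sa sb.
have Da := is_deriveB (smoothf_is_derive u sa) (is_derive_cst (a t) u (1 : R)).
have Db := is_deriveB (smoothf_is_derive u sb) (is_derive_cst (b t) u (1 : R)).
apply: (is_derive_eq (is_deriveB (is_deriveZ (derive1 a t) Db) (is_deriveZ (derive1 b t) Da))).
by rewrite /tangent_det /GRing.scale /= !subr0.
Qed.

Lemma is_derive_tangent_det a b (t u : R) : smoothf a -> smoothf b ->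
  is_derive u 1 (tangent_det a b t) (bending a b t u).
Proof.
move=> sa sb.
have Da := smoothf_is_derive u (smoothf_derive sa).
have Db := smoothf_is_derive u (smoothf_derive sb).
exact: (is_derive_eq (is_deriveB (is_deriveZ (derive1 a t) Db) (is_deriveZ (derive1 b t) Da))).
Qed.

Lemma tangent_height_refl a b (t : R) : tangent_height a b t t = 0.
Proof. by rewrite /tangent_height !subrr !mulr0 subrr. Qed.

Lemma tangent_det_refl a b (t : R) : tangent_det a b t t = 0.
Proof. by rewrite /tangent_det mulrC subrr. Qed.

(** The height and its first derivative in u vanish at u = t, so near t its sign
    is that of the second derivative, on both sides of t. *)
Lemma tangent_height_near a b (t u r : R) : smoothf a -> smoothf b ->
  (forall x, `|x - t| <= r -> 0 < bending a b t x) ->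
  u != t -> `|u - t| <= r -> 0 < tangent_height a b t u.
Proof.
move=> sa sb Hr ut utr.
have Ds (x : R) : is_derive x 1 (tangent_height a b t) (tangent_det a b t x).
  exact: is_derive_tangent_height.
have Dt (x : R) : is_derive x 1 (tangent_det a b t) (bending a b t x).
  exact: is_derive_tangent_det.
have [th /andP[th0 th1]] := mean_value t u Ds.
have [th' /andP[th'0 th'1]] := mean_value t (t + th * (u - t)) Dt.
rewrite tangent_height_refl tangent_det_refl !subr0 (addrC t (th * _)) addrK => -> ->.
set x := t + _; have : 0 < bending a b t x.
  apply: Hr; rewrite /x (addrC t) addrK !normrM (gtr0_norm th0) (gtr0_norm th'0).
  by rewrite mulrA; apply: le_trans utr; rewrite ler_piMl// mulr_ile1// ltW.
move=> bx; rewrite -!mulrA; apply: mulr_gt0 => //; apply: mulr_gt0 => //.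
by rewrite -expr2 exprn_even_gt0// subr_eq0.
Qed.

Lemma tangent_height_periodic a b t u (k : int) : periodic a (2 * pi) -> periodic b (2 * pi) ->
  tangent_height a b t (u + k%:~R * (2 * pi)) = tangent_height a b t u.
Proof. by move=> pa pb; rewrite /tangent_height !periodic_int. Qed.

Lemma det_close (x y x' y' e M : R) : 0 <= e -> `|x| <= M -> `|y'| <= M ->
  `|x' - x| <= e -> `|y' - y| <= e -> `|x' * y' - x * y| <= 2 * e * M.
Proof.
move=> e0 xM yM xe ye.
have -> : x' * y' - x * y = (x' - x) * y' + x * (y' - y) by ring.
rewrite (le_trans (ler_normD _ _))// !normrM.
have -> : 2 * e * M = e * M + M * e by ring.
by rewrite lerD// ler_pM.
Qed.

Lemma periodic_pos_min (f : R -> R) (T : R) : 0 < T -> continuous f -> periodic f T ->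
  (forall t, 0 < f t) -> exists2 c : R, 0 < c & forall t, c <= f t.
Proof.
move=> T0 cf pf fpos.
have [c _ Hc] : exists2 c, c \in `[0, T] & forall t, t \in `[0, T] -> f c <= f t.
  by apply: EVT_min; [exact: ltW|exact: continuous_subspaceT].
exists (f c) => // t; have [k /andP[k0 kT]] := reduce_mod t T0.
by rewrite -(periodic_int t k pf); apply: Hc; rewrite in_itv /= k0 ltW.
Qed.

(** Away from the diagonal the height is bounded below by compactness of the
    set of pairs of parameters. *)
Lemma tangent_height_far a b (r : R) : oval a b -> 0 < r -> r <= pi ->
  exists2 m : R, 0 < m & forall t s, r <= s <= 2 * pi - r -> m <= tangent_height a b t (t + s).
Proof.
move=> [sa sb [pa pb] _ pos] r0 rpi.
have sfc (f : R -> R) : smoothf f -> continuous f by exact: smoothf_continuous.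
pose F (z : R * R) := tangent_height a b z.1 (z.1 + z.2).
have cF : continuous F.
  move=> z; rewrite /F /tangent_height.
  have c1 (f : R -> R) : smoothf f -> {for z, continuous (fun z : R * R => f z.1)}.
    move=> sf; apply: (@continuous_comp _ _ _ fst f); first exact: cvg_fst.
    exact: sfc.
  have c2 (f : R -> R) : smoothf f -> {for z, continuous (fun z : R * R => f (z.1 + z.2))}.
    move=> sf; apply: (@continuous_comp _ _ _ (fun z : R * R => z.1 + z.2) f).
      by apply: cvgD; [exact: cvg_fst|exact: cvg_snd].
    exact: sfc.
  apply: cvgB; (apply: cvgM; [apply: c1; exact: smoothf_derive|]).
    by apply: cvgB; [exact: c2|exact: c1].
  by apply: cvgB; [exact: c2|exact: c1].
pose A := `[0, 2 * pi]%classic `*` `[r, 2 * pi - r]%classic : set (R * R).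
have A0 : A !=set0.
  exists (0, r); rewrite /A /= !in_itv /= !lexx /= ltW ?twopi_gt0//=.
  by split => //; lra.
have cA : compact A by apply: compact_setX; exact: segment_compact.
have [[c1 c2]] := compact_EVT_min A0 cA (continuous_subspaceT cF).
rewrite inE /A /= !in_itv /= => -[_ /andP[rc cr]] Hmin.
exists (F (c1, c2)).
  by apply: pos; rewrite /=; apply/andP; split; lra.
move=> t s rs; have [k /andP[k0 kT]] := reduce_mod t (twopi_gt0 R).
have -> : tangent_height a b t (t + s) = F (t + k%:~R * (2 * pi), s).
  have pa' := periodic_derive1 sa pa; have pb' := periodic_derive1 sb pb.
  by rewrite /F /tangent_height /= addrAC !periodic_int.
by apply: Hmin; rewrite inE /A /= !in_itv /= rs k0 ltW.
Qed.

(** This carries the lower bound on the curvature to the pairs of nearby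
    parameters. *)
Lemma bending_lipschitz a b (M t u : R) : smoothf a -> smoothf b -> 0 < M ->
  (forall k x, (k <= 3)%N -> `|derive1n k a x| <= M) ->
  (forall k x, (k <= 3)%N -> `|derive1n k b x| <= M) ->
  `|bending a b t u - bending a b t t| <= 2 * (M ^+ 2 * `|u - t|).
Proof.
move=> sa sb M0 bA bB.
have sa'' := smoothf_derive (smoothf_derive sa).
have sb'' := smoothf_derive (smoothf_derive sb).
have La := derive_bound_lipschitz t u (fun x => smoothf_is_derive x sa'')
  (fun x => bA 3%N x isT).
have Lb := derive_bound_lipschitz t u (fun x => smoothf_is_derive x sb'')
  (fun x => bB 3%N x isT).
have alg (x y z w p q K : R) : `|x| <= M -> `|z| <= M -> `|y - p| <= M * K ->
    `|w - q| <= M * K -> `|x * y - z * w - (x * p - z * q)| <= 2 * (M ^+ 2 * K).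
  move=> xM zM yp wq.
  have -> : x * y - z * w - (x * p - z * q) = x * (y - p) - z * (w - q) by ring.
  rewrite (le_trans (ler_normB _ _))// !normrM.
  have -> : 2 * (M ^+ 2 * K) = M * (M * K) + M * (M * K) by ring.
  by rewrite lerD// ler_pM.
exact: alg (bA 1%N t isT) (bB 1%N t isT) Lb La.
Qed.

Lemma sub_pos (x y x' y' d c : R) : `|x' - x| <= d -> `|y' - y| <= d ->
  c <= x - y -> 2 * d < c -> 0 < x' - y'.
Proof. by rewrite !ler_norml => /andP[? ?] /andP[? ?] ? ?; lra. Qed.

(** Heights of nearby points are controlled by the second derivatives and
    heights of distant points by the values and first derivatives; both persist
    under perturbations that are small in the C^2 sense. *)
Lemma oval_open a b : oval a b -> exists2 e : R, 0 < e & forall a1 b1,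
  smoothf a1 -> smoothf b1 -> periodic a1 (2 * pi) -> periodic b1 (2 * pi) ->
  (forall k t, (k <= 2)%N -> `|derive1n k a1 t - derive1n k a t| < e) ->
  (forall k t, (k <= 2)%N -> `|derive1n k b1 t - derive1n k b t| < e) ->
  oval a1 b1.
Proof.
move=> ov; have [sa sb [pa pb] Kpos pos] := ov.
have pa' := periodic_derive1 sa pa; have pb' := periodic_derive1 sb pb.
have sa' := smoothf_derive sa; have sb' := smoothf_derive sb.
have sa'' := smoothf_derive sa'; have sb'' := smoothf_derive sb'.
have pi0 := twopi_gt0 R.
have [c c0 Hc] : exists2 c : R, 0 < c & forall t, c <= bending a b t t.
  apply: (@periodic_pos_min (fun t => bending a b t t) _ pi0 _ _ Kpos).
    by apply: smoothf_continuous; apply: smoothfB; exact: smoothfM.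
  move=> t; rewrite /bending !pa' !pb'.
  by rewrite !(periodic_derive1 sa' pa') !(periodic_derive1 sb' pb').
have [M [M0 bA bB]] : exists M : R, [/\ 0 < M,
    forall k t, (k <= 3)%N -> `|derive1n k a t| + 1 <= M
    & forall k t, (k <= 3)%N -> `|derive1n k b t| + 1 <= M].
  have [Ma Ma0 HMa] := smooth_periodic_bounded 3 pi0 sa pa.
  have [Mb Mb0 HMb] := smooth_periodic_bounded 3 pi0 sb pb.
  exists (Ma + Mb + 1); split; first by rewrite !addr_gt0.
    by move=> k t k3; rewrite lerD2r (le_trans (HMa k t k3))// lerDl ltW.
  by move=> k t k3; rewrite lerD2r (le_trans (HMb k t k3))// lerDr ltW.
have bA' k t : (k <= 3)%N -> `|derive1n k a t| <= M.
  by move=> k3; apply: le_trans (bA k t k3); rewrite lerDl.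
have bB' k t : (k <= 3)%N -> `|derive1n k b t| <= M.
  by move=> k3; apply: le_trans (bB k t k3); rewrite lerDl.
have M2 : 0 < M ^+ 2 by exact: exprn_gt0.
(* on the r-neighbourhood of the diagonal the curvature bound c loses at most c/2 *)
have [r [r0 rpi rc]] : exists r : R, [/\ 0 < r, r <= pi & 2 * M ^+ 2 * r <= c / 2].
  exists (Num.min (c / (4 * M ^+ 2)) pi); split.
  - by rewrite lt_min pi_gt0 divr_gt0// mulr_gt0.
  - by rewrite ge_min lexx orbT.
  - have : Num.min (c / (4 * M ^+ 2)) pi <= c / (4 * M ^+ 2) by rewrite ge_min lexx.
    by rewrite ler_pdivlMr ?mulr_gt0//; set r := Num.min _ _; clear; lra.
have [m m0 Hm] := tangent_height_far ov r0 rpi.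
(* close to the diagonal the bending form is controlled by the curvature *)
have alg (x y K : R) : c <= y -> `|x - y| <= 2 * (M ^+ 2 * K) -> K <= r -> c / 2 <= x.
  move=> cy xy Kr; have := ler_wpM2l (ltW M2) Kr; move: xy; rewrite ler_norml => /andP[xy _].
  by move: cy xy rc; clear; lra.
have near t u : `|u - t| <= r -> c / 2 <= bending a b t u.
  exact: alg (Hc t) (bending_lipschitz t u sa sb M0 bA' bB').
(* e M is small against c for the bending form near the diagonal, and against
   m for the height away from it *)
have [e [e0 e1 ec em]] : exists e : R, [/\ 0 < e, e <= 1, 4 * e * M < c / 2 & 8 * e * M < m].
  exists (Num.min 1 (Num.min (c / (16 * M)) (m / (32 * M)))).
  have c1 : Num.min 1 (Num.min (c / (16 * M)) (m / (32 * M))) <= c / (16 * M).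
    by rewrite !ge_min lexx /= orbT.
  have c2 : Num.min 1 (Num.min (c / (16 * M)) (m / (32 * M))) <= m / (32 * M).
    by rewrite !ge_min lexx !orbT.
  rewrite !ler_pdivlMr ?mulr_gt0// in c1 c2.
  split.
  - by rewrite !lt_min ltr01 !divr_gt0// mulr_gt0.
  - by rewrite ge_min lexx.
  - move: c0 c1; set e := Num.min _ _; clear; lra.
  - move: m0 c2; set e := Num.min _ _; clear; lra.
exists e; first exact: e0.
move=> a1 b1 sa1 sb1 pa1 pb1 Ca Cb.
have close_le (x y : R) : `|x - y| < e -> `|y| + 1 <= M -> `|x| <= M.
  move=> xy yM; rewrite -[x](subrK y) (le_trans (ler_normD _ _))//.
  by rewrite addrC (le_trans _ yM)// lerD2l (le_trans (ltW xy)).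
have bA1 k t : (k <= 2)%N -> `|derive1n k a1 t| <= M.
  by move=> k2; apply: close_le (Ca k t k2) (bA k t (leqW k2)).
have bB1 k t : (k <= 2)%N -> `|derive1n k b1 t| <= M.
  by move=> k2; apply: close_le (Cb k t k2) (bB k t (leqW k2)).
have near1 t u : `|u - t| <= r -> 0 < bending a1 b1 t u.
  move=> /near utr.
  have E1 := det_close (ltW e0) (bA' 1%N t isT) (bB1 2%N u isT)
    (ltW (Ca 1%N t isT)) (ltW (Cb 2%N u isT)).
  have E2 := det_close (ltW e0) (bB' 1%N t isT) (bA1 2%N u isT)
    (ltW (Cb 1%N t isT)) (ltW (Ca 2%N u isT)).
  by apply: (sub_pos E1 E2 utr); apply: le_lt_trans ec; rewrite !mulrA -natrM.
split; [exact: sa1|exact: sb1|by split| |].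
  by move=> t; apply: near1; rewrite subrr normr0 ltW.
move=> t u /andP[tu ut].
have [ur|ru] := leP (u - t) r.
  apply: (@tangent_height_near _ _ _ _ r sa1 sb1 (near1 t)); first by rewrite gt_eqF.
  by rewrite gtr0_norm ?subr_gt0.
have [ur|ru'] := leP (2 * pi - r) (u - t).
  rewrite -(tangent_height_periodic t u (-1) pa1 pb1) mulrNz mulN1r.
  apply: (@tangent_height_near _ _ _ _ r sa1 sb1 (near1 t)).
    by rewrite lt_eqF// ltrBlDr.
  by move: ut ur; clear => ? ?; rewrite ltr0_norm; lra.
have := Hm t (u - t); rewrite (ltW ru) (ltW ru') subrKC => /(_ isT) Hmu.
have E2 (f f1 : R -> R) : (forall k t, (k <= 2)%N -> `|derive1n k f1 t - derive1n k f t| < e) ->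
    `|(f1 u - f1 t) - (f u - f t)| <= 2 * e.
  move=> Cf; have -> : (f1 u - f1 t) - (f u - f t) = (f1 u - f u) - (f1 t - f t).
    by clear; ring.
  apply: le_trans (ler_normB _ _) _; rewrite mulr_natl mulr2n.
  by apply: lerD; apply: ltW; exact: (Cf 0%N).
have E3 (f : R -> R) : (forall k t, (k <= 2)%N -> `|derive1n k f t| <= M) ->
    `|f u - f t| <= 2 * M.
  move=> bf; apply: le_trans (ler_normB _ _) _; rewrite mulr_natl mulr2n.
  by apply: lerD; exact: (bf 0%N).
have E4 (x y x' y' : R) : `|x| <= M -> `|y'| <= 2 * M -> `|x' - x| <= e -> `|y' - y| <= 2 * e ->
    `|x' * y' - x * y| <= 4 * e * M.
  move=> xM yM xe ye.
  have -> : x' * y' - x * y = (x' - x) * y' + x * (y' - y) by clear; ring.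
  apply: le_trans (ler_normD _ _) _; rewrite !normrM.
  have -> : 4 * e * M = e * (2 * M) + M * (2 * e) by clear; ring.
  by apply: lerD; apply: ler_pM.
have P1 := E4 _ _ _ _ (bA' 1%N t isT) (E3 _ bB1) (ltW (Ca 1%N t isT)) (E2 _ _ Cb).
have P2 := E4 _ _ _ _ (bB' 1%N t isT) (E3 _ bA1) (ltW (Cb 1%N t isT)) (E2 _ _ Ca).
by apply: (sub_pos P1 P2 Hmu); apply: le_lt_trans em; rewrite !mulrA -natrM.
Qed.

End ovals.

(** * Tables are strictly convex curves *)

Section tables_ovals.
Variable R : realType.
Implicit Types a b : R -> R.

Lemma to_circleP (s t : R) :
  to_circle s = to_circle t <-> exists k : int, t = s + k%:~R * (2 * pi).
Proof.
have pi0 : 2 * pi != 0 :> R by rewrite gt_eqF// twopi_gt0.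
split=> [st|[k ->]].
  have : circle_rel s t by apply/(@eqmodP _ (circle_equivRel R) s t).
  rewrite /circle_rel => /intrP[k kE]; exists k.
  by rewrite -kE divfK// subrKC.
apply/(@eqmodP _ (circle_equivRel R) s); rewrite /= /circle_rel.
by rewrite addrAC subrr add0r mulfK// intr_int.
Qed.

Lemma repr_to_circle (t : R) :
  exists k : int, repr (to_circle t) = t + k%:~R * (2 * pi).
Proof.
have : to_circle t = to_circle (repr (to_circle t)).
  by rewrite {2}/to_circle reprK.
by move=> /to_circleP.
Qed.

Lemma det2E (u v : 'rV[R]_2) : det2 u v = u 0 0 * v 0 1 - u 0 1 * v 0 0.
Proof.
rewrite /det2 (expand_det_row _ 0) !big_ord_recl big_ord0 addr0 /cofactor !det_mx11.
rewrite !mxE /= expr0 mul1r expr1 mulN1r mulrN.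
have -> : lift 0 0 = 1 :> 'I_2 by exact/val_inj.
have -> : lift 1 0 = 0 :> 'I_2 by exact/val_inj.
by [].
Qed.

Lemma mkpt0 (x y : R) : mkpt x y 0 0 = x. Proof. by rewrite mxE. Qed.
Lemma mkpt1 (x y : R) : mkpt x y 0 1 = y. Proof. by rewrite mxE. Qed.
Definition mkptE := (mkpt0, mkpt1).

Lemma mkpt_eta (v : 'rV[R]_2) : mkpt (v 0 0) (v 0 1) = v.
Proof.
apply/rowP => i; rewrite mxE; case: eqVneq => [->//|].
by case: i => [[|[|//]]] //= i2 _; congr (v 0 _); apply/val_inj.
Qed.

Lemma ord2P (P : 'I_2 -> Prop) : P 0 -> P 1 -> forall i, P i.
Proof.
move=> P0 P1 [[|[|//]]] i2.
  by rewrite (_ : Ordinal i2 = 0) //; apply/val_inj.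
by rewrite (_ : Ordinal i2 = 1) //; apply/val_inj.
Qed.

Lemma derive1n_coord (F : R -> 'rV[R]_2) (i : 'I_2) n :
  (forall n (t : R), derivable (derive1n n F) t 1) ->
  derive1n n (fun t => F t 0 i) = fun t => derive1n n F t 0 i.
Proof.
move=> dF; elim: n => // n IH; rewrite derive1nS IH; apply/funext => t.
by rewrite derive1nS [in RHS]derive1E (derive_mx (dF n t)) mxE derive1E.
Qed.

Lemma derive1n_mkpt a b n : smoothf a -> smoothf b ->
  derive1n n (fun t => mkpt (a t) (b t)) =
    (fun t => mkpt (derive1n n a t) (derive1n n b t)) /\
  forall t : R, derivable (derive1n n (fun t => mkpt (a t) (b t))) t 1.
Proof.
move=> sa sb.
have D m (t : R) : derivable (fun t => mkpt (derive1n m a t) (derive1n m b t)) t 1.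
  apply/derivable_mxP => i j; rewrite (ord1 i); move: j; apply: ord2P.
    rewrite (_ : (fun t => _) = derive1n m a); last by apply/funext => x; rewrite mkpt0.
    by case: sa.
  rewrite (_ : (fun t => _) = derive1n m b); last by apply/funext => x; rewrite mkpt1.
  by case: sb.
suff E : derive1n n (fun t => mkpt (a t) (b t)) =
    (fun t => mkpt (derive1n n a t) (derive1n n b t)) by split=> //; rewrite E.
elim: n => // n IH; rewrite derive1nS IH; apply/funext => t.
rewrite derive1E (derive_mx (D n t)); apply/rowP; apply: ord2P; rewrite mxE.
  rewrite mkpt0 derive1nS derive1E; congr ('D_1 _ t).
  by apply/funext => x; rewrite mkpt0.
rewrite mkpt1 derive1nS derive1E; congr ('D_1 _ t).
by apply/funext => x; rewrite mkpt1.
Qed.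

Definition curve_of a b (x : circle R) : 'rV[R]_2 := mkpt (a (repr x)) (b (repr x)).

Lemma lift_curve_of a b : periodic a (2 * pi) -> periodic b (2 * pi) ->
  lift_curve (curve_of a b) = fun t => mkpt (a t) (b t).
Proof.
move=> pa pb; apply/funext => t; rewrite /lift_curve /= /curve_of.
by have [k ->] := repr_to_circle t; rewrite !periodic_int.
Qed.

Lemma dcurve_of a b k : smoothf a -> smoothf b -> periodic a (2 * pi) ->
  periodic b (2 * pi) ->
  dcurve (curve_of a b) k = fun t => mkpt (derive1n k a t) (derive1n k b t).
Proof.
move=> sa sb pa pb; rewrite /dcurve lift_curve_of//.
by have [-> _] := derive1n_mkpt k sa sb.
Qed.

Lemma convex_set_halfplane (c0 c1 c : R) :
  @convex_set R 'rV[R]_2 [set y : 'rV[R]_2 | 0 <= c0 * y 0 0 + c1 * y 0 1 + c].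
Proof.
move=> x y l; rewrite !inE /= => hx hy.
have l0 : 0 <= l%:num by [].
have l1 : 0 <= 1 - l%:num by rewrite subr_ge0.
have -> : conv l x y =
  l%:num *: (x : 'rV[R]_2) + (1 - l%:num) *: (y : 'rV[R]_2) by [].
rewrite !mxE.
have -> : c0 * (l%:num * x 0 0 + (1 - l%:num) * y 0 0) +
  c1 * (l%:num * x 0 1 + (1 - l%:num) * y 0 1) + c =
  l%:num * (c0 * x 0 0 + c1 * x 0 1 + c) + (1 - l%:num) * (c0 * y 0 0 + c1 * y 0 1 + c).
  by ring.
by apply: addr_ge0; apply: mulr_ge0.
Qed.

Lemma convex_hull_conv (A : set 'rV[R]_2) (x y : 'rV[R]_2) (e : R) : 0 < e < 1 ->
  convex_hull A x -> convex_hull A y -> convex_hull A (e *: x + (1 - e) *: y).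
Proof.
move=> /andP[e0 e1] hx hy C [cC sAC].
pose l : {i01 R} := Itv01 (ltW e0) (ltW e1).
have Cx : C x := hx C (conj cC sAC).
have Cy : C y := hy C (conj cC sAC).
exact: set_mem (cC x y l (mem_set Cx) (mem_set Cy)).
Qed.

Lemma sub_convex_hull (A : set 'rV[R]_2) : A `<=` convex_hull A.
Proof. by move=> x Ax C [_ sAC]; exact: sAC. Qed.

(** A homothety centred at a point of the hull maps a neighbourhood of an
    interior point to a neighbourhood contained in the hull. *)
Lemma interior_hull_conv (A : set 'rV[R]_2) (x y : 'rV[R]_2) (e : R) : 0 < e < 1 ->
  (convex_hull A)° x -> convex_hull A y -> (convex_hull A)° (e *: x + (1 - e) *: y).
Proof.
move=> e01 hx hy; have /andP[e0 _] := e01.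
pose phi (z : 'rV[R]_2) := e^-1 *: (z - (1 - e) *: y).
have phix : phi (e *: x + (1 - e) *: y) = x.
  by rewrite /phi addrK scalerA mulVf ?scale1r ?gt_eqF.
have cphi : continuous phi.
  move=> z; apply: (@continuous_comp _ _ _ (fun z : 'rV[R]_2 => z - (1 - e) *: y)
    ( *:%R e^-1)); last exact: scaler_continuous.
  exact: (cvgB (@cvg_id _ (nbhs z)) (cvg_cst ((1 - e) *: y))).
have hphi : nbhs (e *: x + (1 - e) *: y) (phi @^-1` convex_hull A).
  by apply: cphi; rewrite phix.
have sub : phi @^-1` convex_hull A `<=` convex_hull A; last exact: filterS sub hphi.
move=> z hz.
have -> : z = e *: phi z + (1 - e) *: y.
  by rewrite /phi scalerA divff ?gt_eqF// scale1r subrK.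
exact: convex_hull_conv.
Qed.

Lemma det2_affine (u v w : 'rV[R]_2) :
  det2 (u - v) w = - w 0 1 * v 0 0 + w 0 0 * v 0 1 + (u 0 0 * w 0 1 - u 0 1 * w 0 0).
Proof. by rewrite det2E !mxE; ring. Qed.

Definition xcoord (gamma : circle R -> 'rV[R]_2) (t : R) : R := lift_curve gamma t 0 0.
Definition ycoord (gamma : circle R -> 'rV[R]_2) (t : R) : R := lift_curve gamma t 0 1.

(** The counterclockwise condition at interior points passes to the boundary
    points by convexity and gives nonnegative heights.  If the point u were on
    the tangent at t, then the height of u above the tangent at x, as a function
    of x, would be minimal at x = t; its derivative vanishing there, together
    with positive curvature, forces the two points to coincide, against
    injectivity. *)
Lemma table_oval (gamma : circle R -> 'rV[R]_2) (o : 'rV[R]_2) : tables gamma ->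
  (table gamma)° o -> oval (xcoord gamma) (ycoord gamma).
Proof.
move=> [smo reg inj ccw curv] ho.
have E k i : derive1n k (fun t => lift_curve gamma t 0 i) =
  (fun t => dcurve gamma k t 0 i) by exact: derive1n_coord.
have sc i : smoothf (fun t => lift_curve gamma t 0 i).
  split=> n t; rewrite E; have /derivable_mxP := smo n t; exact.
have pc i : periodic (fun t => lift_curve gamma t 0 i) (2 * pi).
  move=> t; rewrite /lift_curve /=; congr (gamma _ 0 i).
  apply/esym/to_circleP; exists 1; by rewrite mul1r.
have x1 : derive1 (xcoord gamma) = fun t => dcurve gamma 1 t 0 0 by exact: (E 1%N 0).
have y1 : derive1 (ycoord gamma) = fun t => dcurve gamma 1 t 0 1 by exact: (E 1%N 1).
have x2 : derive1 (derive1 (xcoord gamma)) = fun t => dcurve gamma 2 t 0 0.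
  exact: (E 2%N 0).
have y2 : derive1 (derive1 (ycoord gamma)) = fun t => dcurve gamma 2 t 0 1.
  exact: (E 2%N 1).
have Kpos t : 0 < bending (xcoord gamma) (ycoord gamma) t t.
  have := curv t; rewrite /curvature det2E.
  rewrite /bending x2 y2 x1 y1; set d := _ - _; move=> dn.
  rewrite ltNge; apply/negP => d0; move: dn; apply/negP; rewrite -leNgt.
  rewrite mulr_le0_ge0// invr_ge0 exprn_ge0//; exact: sqrtr_ge0.
(* weak inequality: an interior point near the point u is seen on the left of
   the tangent at t, and the height is affine on the segment between them *)
have weak t u : 0 <= tangent_height (xcoord gamma) (ycoord gamma) t u.
  pose g (y : 'rV[R]_2) := det2 (lift_curve gamma t - y) (dcurve gamma 1 t).
  have gE : tangent_height (xcoord gamma) (ycoord gamma) t u = g (lift_curve gamma u).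
    rewrite /g det2_affine /tangent_height x1 y1 /xcoord /ycoord.
    have alg (p q x y x' y' : R) : p * (y - y') - q * (x - x') =
      - q * x + p * y + (x' * q - y' * p) by ring.
    exact: alg.
  have gconv (e : R) (x y : 'rV[R]_2) : g (e *: x + (1 - e) *: y) = e * g x + (1 - e) * g y.
    rewrite /g !det2_affine !mxE.
    have alg (p q c v0 v1 w0 w1 : R) : - q * (e * v0 + (1 - e) * w0)
      + p * (e * v1 + (1 - e) * w1) + c = e * (- q * v0 + p * v1 + c)
       + (1 - e) * (- q * w0 + p * w1 + c) by clear; ring.
    exact: alg.
  rewrite gE leNgt; apply/negP => gu.
  have go : 0 < g o by exact: ccw.
  (* e is the weight for which the combination of the two values is - d / 2 *)
  pose d := - g (lift_curve gamma u).
  have d0 : 0 < d by rewrite oppr_gt0.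
  pose e := d / (2 * (g o + d)).
  have den : 0 < 2 * (g o + d) by rewrite mulr_gt0// addr_gt0.
  have e01 : 0 < e < 1.
    rewrite divr_gt0//= ltr_pdivrMr// mul1r.
    by move: d0 go; clear; lra.
  have hu : convex_hull (range gamma) (lift_curve gamma u).
    by apply: sub_convex_hull; exists (to_circle u).
  have := ccw _ (interior_hull_conv e01 ho hu) t; rewrite -/(g _) gconv.
  have -> : g (lift_curve gamma u) = - d by rewrite opprK.
  have -> : e * g o + (1 - e) * - d = e * (2 * (g o + d)) / 2 - d by field.
  rewrite divfK ?gt_eqF//; move: d0; clear; lra.
split=> //; try exact: sc; first by split; exact: pc.
move=> t u /andP[tu ut]; rewrite lt_def weak andbT; apply/negP => /eqP s0.
have sa := sc 0; have sb := sc 1.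
have Dx (x : R) : is_derive x 1 (fun x => tangent_height (xcoord gamma) (ycoord gamma) x u)
    (derive1 (derive1 (xcoord gamma)) x * (ycoord gamma u - ycoord gamma x)
    - derive1 (derive1 (ycoord gamma)) x * (xcoord gamma u - xcoord gamma x)).
  have Da := smoothf_is_derive x sa; have Db := smoothf_is_derive x sb.
  have Da' := smoothf_is_derive x (smoothf_derive sa).
  have Db' := smoothf_is_derive x (smoothf_derive sb).
  have D := is_deriveB
    (is_deriveM Da' (is_deriveB (is_derive_cst (ycoord gamma u) x (1 : R)) Db))
    (is_deriveM Db' (is_deriveB (is_derive_cst (xcoord gamma u) x (1 : R)) Da)).
  apply: (is_derive_eq D).
  have alg (a1 b1 a2 b2 p q : R) : a1 * (0 - b1) + p * a2 - (b1 * (0 - a1) + q * b2)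
    = a2 * p - b2 * q by ring.
  exact: alg.
(* as x varies, the height of the point u above the tangent at x is minimal at t *)
have crit : derive1 (derive1 (xcoord gamma)) t * (ycoord gamma u - ycoord gamma t)
    - derive1 (derive1 (ycoord gamma)) t * (xcoord gamma u - xcoord gamma t) = 0.
  have Dt := Dx t.
  have D0 : is_derive t 1 (fun x => tangent_height (xcoord gamma) (ycoord gamma) x u) 0.
    apply: (@derive1_at_min R _ (t - 1) (t + 1)).
    - by rewrite lerD2l; clear; lra.
    - by move=> x _; exact: ex_derive.
    - by rewrite in_itv /= ltrBlDr !ltrDl ltr01.
    - by move=> x _; rewrite s0.
  by rewrite -(derive_val (is_derive := Dt)) (derive_val (is_derive := D0)).
have K0 := Kpos t.
have alg (a1 b1 a2 b2 p q : R) : a1 * p - b1 * q = 0 -> a2 * p - b2 * q = 0 ->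
    0 < a1 * b2 - b1 * a2 -> p = 0 /\ q = 0.
  move=> h1 h2 K; have Kn0 : a1 * b2 - b1 * a2 != 0 by rewrite gt_eqF.
  split; apply: (mulfI Kn0); rewrite mulr0.
    have -> : (a1 * b2 - b1 * a2) * p = b2 * (a1 * p - b1 * q) - b1 * (a2 * p - b2 * q).
      by ring.
    by rewrite h1 h2 !mulr0 subrr.
  have -> : (a1 * b2 - b1 * a2) * q = a2 * (a1 * p - b1 * q) - a1 * (a2 * p - b2 * q).
    by ring.
  by rewrite h1 h2 !mulr0 subrr.
have [/subr0_eq yE /subr0_eq xE] := alg _ _ _ _ _ _ s0 crit K0.
have : to_circle t = to_circle u.
  apply: inj; rewrite -[LHS]mkpt_eta -[RHS]mkpt_eta.
  by congr (mkpt _ _); [exact: esym xE|exact: esym yE].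
move=> /to_circleP[k uE]; move: tu ut; rewrite uE ltrDl ltrD2l.
rewrite pmulr_lgt0 ?twopi_gt0// => k0 kT.
have k1 : k%:~R < 1 :> R by rewrite -(ltr_pM2r (twopi_gt0 R)) mul1r.
by move: k0 k1; rewrite ltr0z ltrz1; lia.
Qed.

Lemma tangent_height_ge0 a b t u : oval a b -> 0 <= tangent_height a b t u.
Proof.
move=> [sa sb [pa pb] _ pos]; have [k /andP[k0 kT]] := reduce_mod (u - t) (twopi_gt0 R).
rewrite -(tangent_height_periodic t u k pa pb).
have [E|ne] := eqVneq (u - t + k%:~R * (2 * pi)) 0.
  have -> : u + k%:~R * (2 * pi) = t by rewrite -[RHS]addr0 -E addrA subrKC.
  by rewrite tangent_height_refl.
have w0 : 0 < u - t + k%:~R * (2 * pi) by rewrite lt_def ne k0.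
by apply/ltW/pos; apply/andP; split; move: w0 kT; clear; lra.
Qed.

Lemma bending_velocity a b (t : R) : 0 < bending a b t t ->
  derive1 a t = 0 -> derive1 b t = 0 -> False.
Proof.
have alg (x y z w : R) : 0 < x * y - z * w -> x = 0 -> z = 0 -> False.
  by move=> K x0 z0; move: K; rewrite x0 z0 !mul0r subrr ltxx.
exact: alg.
Qed.

(** Two parameters with the same image would have height zero, and the hull lies
    in each left half-plane of a tangent, its interior in the open half-plane;
    this gives injectivity and the counterclockwise orientation. *)
Lemma oval_table a b : oval a b -> tables (curve_of a b).
Proof.
move=> ov; have [sa sb [pa pb] Kpos pos] := ov.
have dE := dcurve_of _ sa sb pa pb.
have lE := lift_curve_of pa pb.
split.
- move=> n t; rewrite /dcurve lE; have [_] := derive1n_mkpt n sa sb; exact.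
- move=> t; rewrite dE; apply/eqP => /rowP v0.
  have := v0 0; have := v0 1; rewrite !mkptE !mxE => b0 a0.
  exact: bending_velocity (Kpos t) a0 b0.
- move=> x y; rewrite /curve_of => xy.
  have xa : a (repr x) = a (repr y) by have := congr1 (fun v : 'rV[R]_2 => v 0 0) xy; rewrite !mkptE.
  have xb : b (repr x) = b (repr y) by have := congr1 (fun v : 'rV[R]_2 => v 0 1) xy; rewrite !mkptE.
  (* two points with the same image have height zero, once y is moved into the
   turn that starts at x *)
  have [k /andP[k0 kT]] := reduce_mod (repr y - repr x) (twopi_gt0 R).
  have [E|ne] := eqVneq (repr y - repr x + k%:~R * (2 * pi)) 0.
    rewrite -[x]reprK -[y]reprK; apply/to_circleP; exists (- k).
    by rewrite mulrNz mulNr; move: E; clear; lra.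
  have : 0 < tangent_height a b (repr x) (repr y + k%:~R * (2 * pi)).
    have w0 : 0 < repr y - repr x + k%:~R * (2 * pi) by rewrite lt_def ne k0.
    by apply: pos; apply/andP; split; move: w0 kT; clear; lra.
  by rewrite tangent_height_periodic// /tangent_height xa xb !subrr !mulr0 subrr ltxx.
- move=> o ho t; rewrite lE dE det2_affine !mkptE.
  pose c0 := - derive1 b t; pose c1 := derive1 a t.
  pose c := a t * derive1 b t - b t * derive1 a t.
  have half : table (curve_of a b) `<=` [set y : 'rV[R]_2 | 0 <= c0 * y 0 0 + c1 * y 0 1 + c].
    move=> y hy; apply: hy; split; first exact: convex_set_halfplane.
    move=> _ [x _ <-]; rewrite /= /curve_of !mkptE.
    have := tangent_height_ge0 t (repr x) ov; rewrite /tangent_height /c0 /c1 /c.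
    have alg (p q v w v' w' : R) : p * (w' - w) - q * (v' - v)
      = - q * v' + p * w' + (v * q - w * p) by clear; ring.
    by rewrite alg.
  have np : 0 < c0 ^+ 2 + c1 ^+ 2.
    rewrite lt_def addr_ge0 ?sqr_ge0// andbT paddr_eq0 ?sqr_ge0// !sqrf_eq0.
    apply/negP => /andP[/eqP b0 /eqP a0].
    by apply: bending_velocity (Kpos t) a0 _; apply/eqP; rewrite -oppr_eq0; apply/eqP.
  (* moving o towards the tangent stays in the half-plane, so o is off its boundary *)
  have [e e0 he] : exists2 e : R, 0 < e & table (curve_of a b) (o - e *: mkpt c0 c1).
    have cphi : continuous (fun e : R => o - e *: mkpt c0 c1 : 'rV[R]_2).
      move=> x; apply: (cvgB (cvg_cst o)).
      exact: (cvgZr_tmp (@cvg_id _ (nbhs x))).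
    have hphi : nbhs (0 : R) ((fun e : R => o - e *: mkpt c0 c1 : 'rV[R]_2) @^-1` table (curve_of a b)).
      by apply: cphi; rewrite scale0r subr0.
    have [r /= r0 hr] := (nbhs_ballP _ _).1 hphi.
    exists (r / 2); first by rewrite divr_gt0.
    apply: hr; rewrite /ball /= sub0r normrN gtr0_norm ?divr_gt0//.
    by rewrite ltr_pdivrMr// mulr_natr mulr2n ltrDl.
  have := half _ he; rewrite /= !mxE.
  rewrite -/c0 -/c1 -/c /=; move: np e0; clear => np e0 H.
  have := mulr_gt0 e0 np; move: H.
  have -> : c0 * (o 0 0 - e * c0) + c1 * (o 0 1 - e * c1) + c =
     c0 * o 0 0 + c1 * o 0 1 + c - e * (c0 ^+ 2 + c1 ^+ 2) by ring.
  rewrite subr_ge0 => h1 h2; exact: lt_le_trans h2 h1.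
- move=> t; rewrite /curvature !dE det2E !mkptE.
  have En : 0 < enorm (mkpt (derive1n 1 a t) (derive1n 1 b t)).
    rewrite /enorm sqrtr_gt0 !big_ord_recl big_ord0 addr0.
    have -> : lift ord0 ord0 = 1 :> 'I_2 by exact/val_inj.
    rewrite !mkptE lt_def addr_ge0 ?sqr_ge0// andbT paddr_eq0 ?sqr_ge0// !sqrf_eq0.
    by apply/negP => /andP[/eqP a0 /eqP b0]; exact: bending_velocity (Kpos t) a0 b0.
  by apply: divr_gt0; [exact: Kpos|exact: exprn_gt0].
Qed.

End tables_ovals.

(** * The parameter with opposite tangent direction *)

Section opposite_tangent.
Variable R : realType.
Implicit Types a b : R -> R.

Lemma height_gt0 a b (t u : R) : oval a b -> t < u < t + 2 * pi -> 0 < tangent_height a b t u.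
Proof. by case=> _ _ _ _; apply. Qed.

(** The same inequality with t and u exchanged, since t + 2 pi follows u. *)
Lemma height_gt0_sym a b (t u : R) : oval a b -> t < u < t + 2 * pi -> 0 < tangent_height a b u t.
Proof.
move=> ov tu; have [_ _ [pa pb] _ _] := ov.
rewrite -[X in tangent_height a b u X](addrK (2 * pi)) -mulN1r.
rewrite (_ : -1 = (-1)%:~R) // tangent_height_periodic//.
by apply: (height_gt0 ov); move: tu; clear => /andP[? ?]; apply/andP; split; lra.
Qed.

(** Vectors v, z, u attached to three points cannot be parallel if each of the
    three lines has the two other points strictly on its left: for any two of
    the vectors this forces opposite directions, which is impossible for
    three. *)
Lemma parallel_heights (v1 v2 z1 z2 u1 u2 at_ bt az bz au bu : R) :
  v1 * z2 - v2 * z1 = 0 -> v1 * u2 - v2 * u1 = 0 ->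
  0 < v1 * (bz - bt) - v2 * (az - at_) ->
  0 < z1 * (bt - bz) - z2 * (at_ - az) ->
  0 < v1 * (bu - bt) - v2 * (au - at_) ->
  0 < u1 * (bt - bu) - u2 * (at_ - au) ->
  0 < z1 * (bu - bz) - z2 * (au - az) ->
  0 < u1 * (bz - bu) - u2 * (az - au) -> False.
Proof.
move=> Dz Du h1 h2 h3 h4 h5 h6.
have prop w1 w2 p q p' q' : v1 * w2 - v2 * w1 = 0 ->
    (v1 * q - v2 * p) * (w1 * q' - w2 * p') = (w1 * q - w2 * p) * (v1 * q' - v2 * p').
  move=> Dw.
  have -> : (v1 * q - v2 * p) * (w1 * q' - w2 * p') =
    (w1 * q - w2 * p) * (v1 * q' - v2 * p')
    + (v1 * w2 - v2 * w1) * (p * q' - q * p') by ring.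
  by rewrite Dw mul0r addr0.
have E1 := prop _ _ (az - at_) (bz - bt) (au - az) (bu - bz) Dz.
have E2 := prop _ _ (au - at_) (bu - bt) (au - az) (bu - bz) Du.
have [X0|X0] := leP 0 (v1 * (bu - bz) - v2 * (au - az)).
  have := mulr_gt0 h1 h5; have := mulr_ge0 X0 (ltW h2).
  move: E1; clear; lra.
have X1 : 0 < - (v1 * (bu - bz) - v2 * (au - az)) by rewrite oppr_gt0.
have := mulr_gt0 h3 h6; have := mulr_gt0 X1 h4.
move: E2; clear; lra.
Qed.

Lemma tangent_det_uniq_zero a b (t z u : R) : oval a b ->
  t < z < t + 2 * pi -> t < u < t + 2 * pi -> z < u ->
  tangent_det a b t z = 0 -> tangent_det a b t u = 0 -> False.
Proof.
move=> ov tz tu zu Dz Du.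
have zu2 : z < u < z + 2 * pi.
  by move: tz tu zu; clear => /andP[? ?] /andP[? ?] ?; apply/andP; split; lra.
exact: (parallel_heights Dz Du (height_gt0 ov tz) (height_gt0_sym ov tz)
  (height_gt0 ov tu) (height_gt0_sym ov tu) (height_gt0 ov zu2) (height_gt0_sym ov zu2)).
Qed.

Lemma continuous_tangent_det a b (t : R) : smoothf a -> smoothf b ->
  continuous (tangent_det a b t).
Proof.
move=> sa sb x; apply: differentiable_continuous; apply/derivable1_diffP.
exact: (ex_derive (is_derive := is_derive_tangent_det t x sa sb)).
Qed.

Lemma height_turn a b (t : R) : periodic a (2 * pi) -> periodic b (2 * pi) ->
  tangent_height a b t (t + 2 * pi) = 0.
Proof.
move=> pa pb; have := tangent_height_periodic t t 1 pa pb; rewrite mul1r => ->.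
exact: tangent_height_refl.
Qed.

(** A zero exists by Rolle's theorem applied to the height above the tangent at
    t, which vanishes at t and at t + 2 pi, and it is unique by
    [parallel_heights].  The signs follow from the intermediate value theorem:
    a wrong sign would produce a second zero, since the height increases at some
    point after t and decreases at some point before t + 2 pi. *)
Lemma opposite_parameter a b (t : R) : oval a b -> exists z : R, [/\ t < z < t + 2 * pi,
  tangent_det a b t z = 0,
  forall u, t < u < z -> 0 < tangent_det a b t u
  & forall u, z < u < t + 2 * pi -> tangent_det a b t u < 0].
Proof.
move=> ov; have [sa sb [pa pb] _ _] := ov; have pi0 := twopi_gt0 R.
have T0 : t < t + 2 * pi by rewrite ltrDl.
have D (x : R) := is_derive_tangent_height t x sa sb.
have [||z ztT Dz] := @Rolle R (tangent_height a b t) t (t + 2 * pi) T0 (fun x _ => ex_derive (is_derive := D x)).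
- apply: derivable_within_continuous => x _; exact: (ex_derive (is_derive := D x)).
- by rewrite (height_turn _ pa pb) tangent_height_refl.
have Dz0 : tangent_det a b t z = 0.
  by rewrite -(derive_val (is_derive := D z)) (derive_val (is_derive := Dz)).
have tz : t < z < t + 2 * pi by move: ztT; rewrite in_itv.
have /andP[z1 z2] := tz.
have cw (x y : R) : {within `[x, y], continuous (tangent_det a b t)}.
  by apply: continuous_subspaceT; exact: (continuous_tangent_det sa sb).
have uniq u : t < u < t + 2 * pi -> tangent_det a b t u = 0 -> u = z.
  move=> tu Du; case: (ltgtP u z) => // uz; exfalso.
    exact: tangent_det_uniq_zero ov tu tz uz Du Dz0.
  exact: tangent_det_uniq_zero ov tz tu uz Dz0 Du.
exists z; split=> // u /andP[u1 u2].
  rewrite ltNge; apply/negP => Du.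
  have tu : t < u < t + 2 * pi by rewrite u1 (lt_trans u2).
  have [th /andP[th0 th1]] := mean_value t u D.
  rewrite tangent_height_refl subr0; set x := t + _ => xE.
  have xu : t < x < u.
    rewrite /x ltrDl mulr_gt0 ?subr_gt0//= -ltrBrDl.
    by rewrite gtr_pMl ?subr_gt0.
  have Dx : 0 < tangent_det a b t x.
    have : 0 < tangent_det a b t x * (u - t) by rewrite -xE (height_gt0 ov tu).
    by rewrite pmulr_lgt0 ?subr_gt0.
  have /andP[tx xltu] := xu.
  have mM : Num.min (tangent_det a b t x) (tangent_det a b t u) <= 0 <=
      Num.max (tangent_det a b t x) (tangent_det a b t u).
    by rewrite ge_min Du orbT le_max (ltW Dx).
  have [c] := IVT (ltW xltu) (cw _ _) mM.
  rewrite in_itv /= => /andP[xc cu] Dc.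
  have cz : c = z by apply: uniq Dc; rewrite (lt_le_trans tx)//= (le_lt_trans cu)// (lt_trans u2).
  by move: cu; rewrite cz leNgt u2.
rewrite ltNge; apply/negP => Du.
have tu : t < u < t + 2 * pi by rewrite u2 (lt_trans z1).
have [th /andP[th0 th1]] := mean_value u (t + 2 * pi) D.
rewrite (height_turn _ pa pb) sub0r; set x := u + _ => xE.
have xu : u < x < t + 2 * pi.
  rewrite /x ltrDl mulr_gt0 ?subr_gt0//= -ltrBrDl.
  by rewrite gtr_pMl ?subr_gt0.
have Dx : tangent_det a b t x < 0.
  have := height_gt0 ov tu; rewrite -oppr_lt0 xE pmulr_llt0 ?subr_gt0//.
have /andP[ux xT] := xu.
have mM : Num.min (tangent_det a b t u) (tangent_det a b t x) <= 0 <=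
    Num.max (tangent_det a b t u) (tangent_det a b t x).
  by rewrite ge_min (ltW Dx) orbT le_max Du.
have [c] := IVT (ltW ux) (cw _ _) mM.
rewrite in_itv /= => /andP[uc cx] Dc.
have cz : c = z by apply: uniq Dc; rewrite (lt_le_trans _ uc) ?(lt_trans z1)//= (le_lt_trans cx).
by move: uc; rewrite cz leNgt u1.
Qed.

End opposite_tangent.

(** * The generating function and the implicit equation of the map *)

Section generating_function.
Variable R : realType.
Implicit Types (a b : R -> R) (o : 'rV[R]_2).

Definition dgen1 a b o (t u : R) : R :=
  derive1 a t * (b u - o 0 1) - derive1 b t * (a u - o 0 0).
Definition dgen2 a b o (t u : R) : R :=
  (a t - o 0 0) * derive1 b u - (b t - o 0 1) * derive1 a u.

Lemma genE a b o : periodic a (2 * pi) -> periodic b (2 * pi) ->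
  gen (curve_of a b) o = fun t u =>
    (a t - o 0 0) * (b u - o 0 1) - (b t - o 0 1) * (a u - o 0 0).
Proof.
move=> pa pb; apply/funext => t; apply/funext => u.
by rewrite /gen lift_curve_of// det2E !mxE /=.
Qed.

Lemma gen1E a b o : oval a b -> gen1 (curve_of a b) o = dgen1 a b o.
Proof.
move=> [sa sb [pa pb] _ _]; apply/funext => t; apply/funext => u.
rewrite /gen1 genE//.
have Da := is_deriveB (smoothf_is_derive t sa) (is_derive_cst (o 0 0) t (1 : R)).
have Db := is_deriveB (smoothf_is_derive t sb) (is_derive_cst (o 0 1) t (1 : R)).
have D := is_deriveB (is_deriveZ (b u - o 0 1) Da) (is_deriveZ (a u - o 0 0) Db).
have -> : (fun t => (a t - o 0 0) * (b u - o 0 1) - (b t - o 0 1) * (a u - o 0 0)) =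
  ((b u - o 0 1) *: (a - cst (o 0 0)) - (a u - o 0 0) *: (b - cst (o 0 1))).
  by apply/funext => x; congr (_ - _); exact: mulrC.
rewrite derive1E (derive_val (is_derive := D)) /dgen1 !subr0.
by congr (_ - _); exact: mulrC.
Qed.

Lemma gen2E a b o : oval a b -> gen2 (curve_of a b) o = dgen2 a b o.
Proof.
move=> [sa sb [pa pb] _ _]; apply/funext => t; apply/funext => u.
rewrite /gen2 genE//.
have Da := is_deriveB (smoothf_is_derive u sa) (is_derive_cst (o 0 0) u (1 : R)).
have Db := is_deriveB (smoothf_is_derive u sb) (is_derive_cst (o 0 1) u (1 : R)).
have D := is_deriveB (is_deriveZ (a t - o 0 0) Db) (is_deriveZ (b t - o 0 1) Da).
have -> : (fun u => (a t - o 0 0) * (b u - o 0 1) - (b t - o 0 1) * (a u - o 0 0)) =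
  ((a t - o 0 0) *: (b - cst (o 0 1)) - (b t - o 0 1) *: (a - cst (o 0 0))).
  by apply/funext => x.
by rewrite derive1E (derive_val (is_derive := D)) /dgen2 !subr0.
Qed.

Lemma is_derive_dgen1_r a b o (t u : R) : smoothf a -> smoothf b ->
  is_derive u 1 (dgen1 a b o t) (tangent_det a b t u).
Proof.
move=> sa sb.
have Da := is_deriveB (smoothf_is_derive u sa) (is_derive_cst (o 0 0) u (1 : R)).
have Db := is_deriveB (smoothf_is_derive u sb) (is_derive_cst (o 0 1) u (1 : R)).
apply: (is_derive_eq (is_deriveB (is_deriveZ (derive1 a t) Db) (is_deriveZ (derive1 b t) Da))).
by rewrite !subr0.
Qed.

Definition dgen11 a b o (t u : R) : R :=
  derive1 (derive1 a) t * (b u - o 0 1) - derive1 (derive1 b) t * (a u - o 0 0).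
Definition dgen22 a b o (t u : R) : R :=
  (a t - o 0 0) * derive1 (derive1 b) u - (b t - o 0 1) * derive1 (derive1 a) u.

Lemma is_derive_dgen1_l a b o (t u : R) : smoothf a -> smoothf b ->
  is_derive t 1 (fun t => dgen1 a b o t u) (dgen11 a b o t u).
Proof.
move=> sa sb.
have Da := smoothf_is_derive t (smoothf_derive sa).
have Db := smoothf_is_derive t (smoothf_derive sb).
have D := is_deriveB (is_deriveZ (b u - o 0 1) Da) (is_deriveZ (a u - o 0 0) Db).
have -> : (fun t => dgen1 a b o t u) =
    (b u - o 0 1) *: derive1 a - (a u - o 0 0) *: derive1 b.
  by apply/funext => x; congr (_ - _); exact: mulrC.
by apply: (is_derive_eq D); congr (_ - _); exact: mulrC.
Qed.

(** The uniqueness in [opposite_parameter] determines the chosen value of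
    star. *)
Lemma star_spec a b (t : R) : oval a b ->
  let z := star (curve_of a b) t in
  [/\ t < z < t + 2 * pi,
      forall u, t < u < z -> 0 < tangent_det a b t u
    & forall u, t < u < t + 2 * pi -> 0 < tangent_det a b t u -> u < z].
Proof.
move=> ov z; have [sa sb [pa pb] _ _] := ov.
have detE u : det2 (dcurve (curve_of a b) 1 t) (dcurve (curve_of a b) 1 u) =
    tangent_det a b t u.
  by rewrite (dcurve_of 1 sa sb pa pb) det2E !mkptE.
have [z' [tz' Dz' pos neg]] := opposite_parameter t ov.
have [tz Dz] : t < z < t + 2 * pi /\ det2 (dcurve (curve_of a b) 1 t) (dcurve (curve_of a b) 1 z) = 0.
  pose P := [set u | t < u < t + 2 * pi /\
    det2 (dcurve (curve_of a b) 1 t) (dcurve (curve_of a b) 1 u) = 0].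
  by suff : P (get P) by []; apply: getPex; exists z'; rewrite /P /= detE.
rewrite detE in Dz.
have zz' : z = z'.
  have /andP[z1 z2] := tz.
  case: (ltgtP z z') => // zz.
    by have := pos z; rewrite z1 zz Dz ltxx => /(_ isT).
  by have := neg z; rewrite z2 zz Dz ltxx => /(_ isT).
rewrite zz'; split=> // u /andP[u1 u2] Du.
rewrite ltNge le_eqVlt; apply/negP => /orP[/eqP uz|zu].
  by move: Du; rewrite -uz Dz' ltxx.
by have := neg u; rewrite zu u2 => /(_ isT); rewrite ltNge (ltW Du).
Qed.

Lemma dgen1_incr a b o (t u w : R) : oval a b -> t <= u -> u < w ->
  w <= star (curve_of a b) t -> dgen1 a b o t u < dgen1 a b o t w.
Proof.
move=> ov tu uw wz; have [sa sb _ _ _] := ov.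
have [_ pos _] := star_spec t ov.
have D (x : R) := is_derive_dgen1_r o t x sa sb.
have [th /andP[th0 th1] E] := mean_value u w D.
rewrite -subr_gt0 E; apply: mulr_gt0; last by rewrite subr_gt0.
apply: pos; apply/andP; split.
  by rewrite (le_lt_trans tu)// ltrDl mulr_gt0 ?subr_gt0.
apply: lt_le_trans wz; rewrite -ltrBrDl.
by rewrite gtr_pMl ?subr_gt0.
Qed.

Definition next_parameter (gamma : circle R -> 'rV[R]_2) o (x : 'rV[R]_2) : R :=
  get [set t2 | x 0 0 < t2 < star gamma (x 0 0) /\ x 0 1 = - gen1 gamma o (x 0 0) t2].

Lemma next_parameterE a b o (x : 'rV[R]_2) (w : R) : oval a b ->
  x 0 0 < w < star (curve_of a b) (x 0 0) -> x 0 1 = - dgen1 a b o (x 0 0) w ->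
  next_parameter (curve_of a b) o x = w.
Proof.
move=> ov xw xE; rewrite /next_parameter gen1E//; set P := [set _ | _].
have [/andP[w1 w2] /= E] : P (get P) by apply: getPex; exists w.
have /andP[xw1 xw2] := xw; move: E; rewrite xE => /oppr_inj E.
case: (ltgtP (get P) w) => // gw.
  by have := dgen1_incr o ov (ltW w1) gw (ltW xw2); rewrite E ltxx.
by have := dgen1_incr o ov (ltW xw1) gw (ltW w2); rewrite E ltxx.
Qed.

Lemma cover_mapE gamma o x : cover_map gamma o x =
  mkpt (next_parameter gamma o x) (gen2 gamma o (x 0 0) (next_parameter gamma o x)).
Proof. by []. Qed.

Lemma continuous2_dist (F : R * R -> R) (t u e : R) :
  {for (t, u), continuous F} -> 0 < e ->
  exists2 r : R, 0 < r & forall x y, `|x - t| < r -> `|y - u| < r ->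
    `|F (x, y) - F (t, u)| < e.
Proof.
move=> cF e0; have /(cvgrPdist_lt _ _).1 /(_ _ e0) /nbhs_ballP[r /= r0 hr] := cF.
exists r => // x y xt yu; rewrite distrC; apply: (hr (x, y)).
by split; rewrite /ball /= distrC.
Qed.

Lemma continuous2_fun (f g : R -> R) (z : R * R) : smoothf f -> smoothf g ->
  {for z, continuous (fun z : R * R => f z.1 * g z.2)}.
Proof.
move=> sf sg; apply: cvgM.
  apply: (@continuous_comp _ _ _ fst f); first exact: cvg_fst.
  exact: smoothf_continuous.
apply: (@continuous_comp _ _ _ snd g); first exact: cvg_snd.
exact: smoothf_continuous.
Qed.

Lemma tangent_det_near a b (t u e : R) : smoothf a -> smoothf b -> 0 < e ->
  exists2 r : R, 0 < r & forall x y, `|x - t| < r -> `|y - u| < r ->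
    `|tangent_det a b x y - tangent_det a b t u| < e.
Proof.
move=> sa sb; have sa' := smoothf_derive sa; have sb' := smoothf_derive sb.
apply: (@continuous2_dist (fun z => tangent_det a b z.1 z.2)).
by apply: cvgB; exact: continuous2_fun.
Qed.

Lemma dgen11_near a b o (t u e : R) : smoothf a -> smoothf b -> 0 < e ->
  exists2 r : R, 0 < r & forall x, `|x - t| < r ->
    `|dgen11 a b o x u - dgen11 a b o t u| < e.
Proof.
move=> sa sb e0.
have sa2 := smoothf_derive (smoothf_derive sa).
have sb2 := smoothf_derive (smoothf_derive sb).
have c : continuous (fun t => dgen11 a b o t u).
  by apply: smoothf_continuous; apply: smoothfB; apply: smoothfM => //; exact: smoothf_cst.
have /(cvgrPdist_lt _ _).1 /(_ _ e0) /nbhs_ballP[r /= r0 hr] := c t.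
exists r => // x xt; rewrite distrC; apply: (hr x).
by rewrite /ball /= distrC.
Qed.

Lemma linear_root_estimate (L11 L12 e K p q N eta D E s : R) : 0 < L12 -> 0 < e ->
  0 <= N -> `|p| <= N -> `|q| <= N -> K = (1 + `|L11|) / L12 ->
  eta = L12 * e / (2 * (K + e + 1)) ->
  `|D - L12| <= eta -> `|E - L11| <= eta ->
  `|s| <= (K + e) * N ->
  `|D * s + E * p - (L12 * s + L11 * p)| <= L12 * e * N.
Proof.
move=> L0 e0 N0 pN qN KE etaE HD HE sN.
have K0 : 0 < K by rewrite KE divr_gt0// ltr_pwDl.
have den : 0 < 2 * (K + e + 1) by rewrite mulr_gt0// !addr_gt0.
have eta0 : 0 <= eta by apply: le_trans HD.
have -> : D * s + E * p - (L12 * s + L11 * p) = (D - L12) * s + (E - L11) * p by ring.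
rewrite (le_trans (ler_normD _ _))// !normrM.
apply: le_trans (_ : eta * ((K + e) * N) + eta * N <= _).
  by rewrite lerD// ler_pM.
have -> : eta * ((K + e) * N) + eta * N = eta * (2 * (K + e + 1)) * (N / 2) by field.
rewrite etaE divfK ?gt_eqF//.
by rewrite ler_pM2l ?mulr_gt0// ler_pdivrMr// ler_peMr// ler1n.
Qed.

(** The solution s of the linearised equation q + L_11 p + L_12 s = 0, where L
    is the generating function; p and q are the increments of the two
    coordinates on the phase space. *)
Definition dnext a b o (t u p q : R) : R :=
  - (q + dgen11 a b o t u * p) / tangent_det a b t u.

(** A quantitative implicit function theorem.  Substituting for the new
    parameter the linear prediction plus or minus e N changes the sign of the
    equation, because the linear part moves by L_12 e N and the remainder is
    smaller; the root in between is given by the intermediate value theorem and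
    identified by monotonicity. *)
Lemma implicit_root a b o (t u e : R) : oval a b ->
  t < u < star (curve_of a b) t -> 0 < e ->
  exists2 r : R, 0 < r & forall s q N : R, `|s - t| <= N -> `|q| <= N -> N < r ->
    exists w : R, [/\ s < w < star (curve_of a b) s,
      dgen1 a b o s w = dgen1 a b o t u - q
      & `|w - u - dnext a b o t u (s - t) q| <= e * N].
Proof.
move=> ov tu e0; have [sa sb _ _ _] := ov.
have [tz pos _] := star_spec t ov.
have D0 := pos u tu.
set L12 := tangent_det a b t u in D0 *; set L11 := dgen11 a b o t u.
have L11E : dgen11 a b o t u = L11 by [].
have L12E : tangent_det a b t u = L12 by [].
clearbody L11 L12.
(* K bounds the linear prediction; eta is the variation of the two partial
   derivatives for which the remainder is at most L12 e N *)
pose K := (1 + `|L11|) / L12.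
have K0 : 0 < K by rewrite divr_gt0// ltr_pwDl.
have KE1 : 0 < K + e + 1 by rewrite !addr_gt0.
pose eta := L12 * e / (2 * (K + e + 1)).
have eta0 : 0 < eta by rewrite divr_gt0 ?mulr_gt0.
have etaL : eta < L12.
  rewrite ltr_pdivrMr ?mulr_gt0// ltr_pM2l//; move: K0 e0; clear; lra.
have [r1 r10 H1] := tangent_det_near t u sa sb eta0.
have [r2 r20 H2] := dgen11_near o t u sa sb eta0.
rewrite L12E in H1; rewrite L11E in H2.
have u2 : u < t + 2 * pi by move: tu tz => /andP[_ h] /andP[_]; exact: lt_trans.
have [u1 _] := andP tu.
have [r0 [r00 r0r1 r0r2 r0u r0t]] : exists r0 : R, [/\ 0 < r0, r0 <= r1, r0 <= r2,
    2 * r0 <= u - t & 2 * r0 <= t + 2 * pi - u].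
  exists (Num.min (Num.min r1 r2) (Num.min ((u - t) / 2) ((t + 2 * pi - u) / 2))).
  split.
  - by rewrite !lt_min r10 r20 !divr_gt0 ?subr_gt0.
  - by rewrite !ge_min lexx.
  - by rewrite !ge_min lexx !orbT.
  - by rewrite mulrC -ler_pdivlMr// !ge_min lexx !orbT.
  - by rewrite mulrC -ler_pdivlMr// !ge_min lexx !orbT.
exists (r0 / (K + e + 1)); first by rewrite divr_gt0.
move=> s q N sN qN; rewrite ltr_pdivlMr// => Nr.
have N0 : 0 <= N by apply: le_trans sN.
have NK : (K + e) * N < r0.
  by apply: le_lt_trans Nr; rewrite mulrC ler_wpM2l// lerDl.
have Nr0 : N < r0.
  by apply: le_lt_trans Nr; rewrite ler_peMr// lerDr addr_ge0// ltW.
have st : `|s - t| < r0 by exact: le_lt_trans Nr0.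
(* being a second vertex for the first vertex s is an open condition *)
have adm w : `|w - u| < r0 -> s < w < star (curve_of a b) s.
  move=> wu; have [_ _ lt_star] := star_spec s ov.
  have sw : s < w < s + 2 * pi.
    move: wu st r0u r0t; clear; rewrite !ltr_norml => /andP[? ?] /andP[? ?] ? ?.
    by apply/andP; split; lra.
  rewrite (andP sw).1 /=; apply: lt_star => //.
  have := H1 s w (lt_le_trans st r0r1) (lt_le_trans wu r0r1).
  move: etaL; set x := tangent_det a b s w; clear.
  by rewrite ltr_norml => ? /andP[? ?]; lra.
have add_sub (x y : R) : x + y - x = y by rewrite addrAC subrr add0r.
have Du (x : R) := is_derive_dgen1_r o s x sa sb.
have Dl (x : R) := is_derive_dgen1_l o x u sa sb.
have [th' /andP[th'0 th'1] El] := mean_value t s Dl.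
have expansion d : `|d| <= (K + e) * N ->
  `|dgen1 a b o s (u + d) - dgen1 a b o t u - (L12 * d + L11 * (s - t))| <= L12 * e * N.
  move=> dN; have [th /andP[th0 th1] Er] := mean_value u (u + d) Du.
  rewrite add_sub in Er.
  have -> : dgen1 a b o s (u + d) - dgen1 a b o t u =
    tangent_det a b s (u + th * d) * d + dgen11 a b o (t + th' * (s - t)) u * (s - t).
    by rewrite -Er -El addrA subrK.
  have thd x (k : R) : 0 < k -> k < 1 -> `|k * x| <= `|x|.
    by move=> k0 k1; rewrite normrM gtr0_norm// ler_piMl// ltW.
  apply: (linear_root_estimate D0 e0 N0 sN qN erefl erefl _ _ dN); apply: ltW.
    apply: H1; first exact: lt_le_trans r0r1.
    rewrite add_sub; apply: le_lt_trans (thd _ _ th0 th1) _.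
    exact: le_lt_trans dN (lt_le_trans NK r0r1).
  apply: H2; rewrite add_sub; apply: le_lt_trans (thd _ _ th'0 th'1) _.
  exact: lt_le_trans r0r2.
pose l := dnext a b o t u (s - t) q.
have lE : L12 * l = - (q + L11 * (s - t)).
  by rewrite /l /dnext L12E L11E mulrC divfK// gt_eqF.
have lK : `|l| <= K * N.
  rewrite /l /dnext L12E L11E normrM normrN normfV (gtr0_norm D0) /K mulrAC.
  rewrite ler_pM2r ?invr_gt0// (le_trans (ler_normD _ _))// mulrDl mul1r lerD//.
  by rewrite normrM ler_wpM2l.
have eN : 0 <= e * N by rewrite mulr_ge0// ltW.
have lp : `|l + e * N| <= (K + e) * N.
  rewrite (le_trans (ler_normD _ _))// mulrDl lerD//.
  by rewrite ger0_norm.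
have lm : `|l - e * N| <= (K + e) * N.
  rewrite (le_trans (ler_normB _ _))// mulrDl lerD//.
  by rewrite ger0_norm.
have Ep := expansion _ lp; have Em := expansion _ lm.
rewrite mulrDr lE in Ep; rewrite mulrBr lE in Em.
have fm : dgen1 a b o s (u + (l - e * N)) <= dgen1 a b o t u - q.
  move: Em; set X := dgen1 a b o s _; set Y := dgen1 a b o t u; clear.
  by rewrite ler_norml => /andP[? ?]; lra.
have fp : dgen1 a b o t u - q <= dgen1 a b o s (u + (l + e * N)).
  move: Ep; set X := dgen1 a b o s _; set Y := dgen1 a b o t u; clear.
  by rewrite ler_norml => /andP[? ?]; lra.
have le_mp : u + (l - e * N) <= u + (l + e * N).
  by rewrite lerD2l lerD2l; move: eN; clear; lra.
have cf : {within `[u + (l - e * N), u + (l + e * N)], continuous (dgen1 a b o s)}.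
  by apply: derivable_within_continuous => x _; exact: (ex_derive (is_derive := Du x)).
have mM : Num.min (dgen1 a b o s (u + (l - e * N))) (dgen1 a b o s (u + (l + e * N)))
    <= dgen1 a b o t u - q <=
    Num.max (dgen1 a b o s (u + (l - e * N))) (dgen1 a b o s (u + (l + e * N))).
  by rewrite ge_min fm le_max fp orbT.
have [w] := IVT le_mp cf mM; rewrite in_itv /= => /andP[w1 w2] wE.
have wl : `|w - u - l| <= e * N.
  move: w1 w2; clear => ? ?; rewrite ler_norml; apply/andP; split; lra.
exists w; split; [|exact: wE|exact: wl]; apply: adm; apply: le_lt_trans NK.
have -> : w - u = (w - u - l) + l by rewrite subrK.
by rewrite (le_trans (ler_normD _ _))// addrC mulrDl lerD.
Qed.

End generating_function.

(** * Differential of the billiard map *)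

Section differentiability.
Variable R : realType.
Implicit Types (a b : R -> R) (o : 'rV[R]_2).

Lemma coord_le_norm (v : 'rV[R]_2) i : `|v 0 i| <= `|v|.
Proof.
rewrite [leRHS]/Num.Def.normr /= mx_normrE.
exact: (le_bigmax _ (fun ij : 'I_1 * 'I_2 => `|v ij.1 ij.2|) (0, i)).
Qed.

Lemma is_diff_linear_form (f : 'rV[R]_2 -> R) (x : 'rV[R]_2) (c0 c1 : R) :
  (forall e : R, 0 < e -> exists2 r : R, 0 < r & forall v : 'rV[R]_2, `|v| < r ->
    `|f (v + x) - f x - (c0 * v 0 0 + c1 * v 0 1)| <= e * `|v|) ->
  is_diff x f (fun v => c0 * v 0 0 + c1 * v 0 1).
Proof.
move=> est; set d := fun v => _.
have dlin : linear d.
  by move=> k u v; rewrite /d !mxE /GRing.scale /=; ring.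
pose dM := GRing.isLinear.Build _ _ _ _ _ dlin.
pose dL : {linear 'rV[R]_2 -> R} := HB.pack d dM.
have dc : continuous dL.
  have cc (c : R) i : continuous (fun v : 'rV[R]_2 => c * v 0 i).
    move=> v; apply: (@continuousM _ _ (fun=> c) (fun v : 'rV[R]_2 => v 0 i)).
      exact: cst_continuous.
    exact: coord_continuous.
  move=> v; exact: (continuousD (cc c0 0 v) (cc c1 1 v)).
have main : f \o shift x = cst (f x) + dL +o_ (0 : 'rV[R]_2) id.
  apply/eqaddoP => e e0; have [r r0 hr] := est e e0.
  apply/nbhs_ballP; exists r => //= v; rewrite -ball_normE /= sub0r normrN => vr.
  have := hr v vr; rewrite /= !fctE /= -/(d v).
  by rewrite (opprD (f x)) addrA.

have dE : 'd f x = dL :> (_ -> _) by apply: diff_unique.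
apply: DiffDef; last exact: dE.
by apply/diff_locallyP; rewrite dE; split.
Qed.

Lemma is_diff_comp_derive (f : R -> R) (df : R) (g dg : 'rV[R]_2 -> R) (x : 'rV[R]_2) :
  is_derive (g x) 1 f df -> is_diff x g dg ->
  is_diff x (fun y => f (g y)) (fun v => dg v * df).
Proof.
move=> Df Dg; have fd : differentiable f (g x).
  by apply/derivable1_diffP; exact: (ex_derive (is_derive := Df)).
have Df' : is_diff (g x) f (fun h => h *: df).
  apply: DiffDef => //; rewrite diff1E//.
  by rewrite derive1E (derive_val (is_derive := Df)).
exact: (is_diff_comp Dg Df').
Qed.

Lemma is_diff_coord (x : 'rV[R]_2) i : is_diff x (fun v : 'rV[R]_2 => v 0 i) (fun v => v 0 i).
Proof.
pose d (v : 'rV[R]_2) := v 0 i.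
have dlin : linear d by move=> k u v; rewrite /d !mxE.
pose dM := GRing.isLinear.Build _ _ _ _ _ dlin.
pose dL : {linear 'rV[R]_2 -> R} := HB.pack d dM.
have dc : continuous dL by move=> v; exact: coord_continuous.
apply: DiffDef; first exact: (@linear_differentiable _ _ _ dL).
exact: (@diff_lin _ _ _ dL).
Qed.

Lemma is_diff_mkpt (f g df dg : 'rV[R]_2 -> R) (x : 'rV[R]_2) :
  is_diff x f df -> is_diff x g dg ->
  is_diff x (fun y => mkpt (f y) (g y)) (fun v => mkpt (df v) (dg v)).
Proof.
move=> Df Dg.
have mkE (p q : R) : mkpt p q = p *: mkpt 1 0 + q *: mkpt 0 1.
  by apply/rowP; apply: ord2P; rewrite !mxE /= ?mulr0 ?mulr1 ?addr0 ?add0r.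
have -> : (fun y => mkpt (f y) (g y)) =
    (fun y => f y *: mkpt 1 0) + (fun y => g y *: mkpt 0 1).
  by apply/funext => y; rewrite mkE.
have -> : (fun v => mkpt (df v) (dg v)) =
    (fun v => df v *: mkpt 1 0) + (fun v => dg v *: mkpt 0 1).
  by apply/funext => y; rewrite mkE.
have Z (h dh : 'rV[R]_2 -> R) (w : 'rV[R]_2) : is_diff x h dh ->
    is_diff x (fun y => h y *: w) (fun v => dh v *: w).
  move=> Dh; have hd : differentiable h x by exact: ex_diff.
  apply: DiffDef; first exact: differentiableZl.
  by rewrite diffZl// diff_val.
exact: is_diffD (Z _ _ _ Df) (Z _ _ _ Dg).
Qed.

(** This is the estimate of [implicit_root] read as the definition of the
    differential. *)
Lemma is_diff_next_parameter a b o (t u : R) : oval a b ->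
  t < u < star (curve_of a b) t ->
  is_diff (mkpt t (- dgen1 a b o t u)) (next_parameter (curve_of a b) o)
    (fun v => dnext a b o t u (v 0 0) (v 0 1)).
Proof.
move=> ov tu; set x := mkpt t _.
have -> : (fun v : 'rV[R]_2 => dnext a b o t u (v 0 0) (v 0 1)) =
   (fun v : 'rV[R]_2 => - dgen11 a b o t u / tangent_det a b t u * v 0 0
     + - (tangent_det a b t u)^-1 * v 0 1).
  apply/funext => v; rewrite /dnext.
  have alg (p q r s : R) : - (q + r * p) * s = - r * s * p + - s * q by ring.
  exact: alg.
apply: is_diff_linear_form => e e0.
have [r r0 hr] := implicit_root o ov tu e0; exists r => // v vr.
have x0 : next_parameter (curve_of a b) o x = u.
  apply: (next_parameterE ov); rewrite /x !mkptE; [exact: tu|reflexivity].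
have h0 : `|v 0 0 + t - t| <= `|v| by rewrite addrK; exact: coord_le_norm.
have vx0 : (v + x) 0 0 = v 0 0 + t by rewrite mxE mkptE.
have vx1 : (v + x) 0 1 = v 0 1 - dgen1 a b o t u by rewrite mxE mkptE.
have [w [wr wE west]] := hr _ _ _ h0 (coord_le_norm v 1) vr.
have xw : next_parameter (curve_of a b) o (v + x) = w.
  by apply: (next_parameterE ov); rewrite ?vx1 vx0 ?wE ?opprB.
rewrite xw x0; apply: le_trans west; rewrite addrK /dnext.
have alg (p q l s : R) : - l * s * p + - s * q = - (q + l * p) * s by clear; ring.
by rewrite (alg (v 0 0) (v 0 1)).
Qed.

Lemma is_diff_cover_map a b o (t u : R) : oval a b ->
  t < u < star (curve_of a b) t ->
  is_diff (mkpt t (- dgen1 a b o t u)) (cover_map (curve_of a b) o)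
    (fun v => let d := dnext a b o t u (v 0 0) (v 0 1) in
      mkpt d (tangent_det a b t u * v 0 0 + dgen22 a b o t u * d)).
Proof.
move=> ov tu; set x := mkpt t _; have [sa sb _ _ _] := ov.
have Dn := is_diff_next_parameter o ov tu; rewrite -/x in Dn.
have x0 : next_parameter (curve_of a b) o x = u.
  apply: (next_parameterE ov); rewrite /x !mkptE; [exact: tu|reflexivity].
have D0 := is_diff_coord x 0.
have xt : x 0 0 = t by rewrite /x mkptE.
have Ca : is_derive (x 0 0) 1 (a - cst (o 0 0)) (derive1 a t - 0).
  by rewrite xt; apply: is_deriveB; exact: smoothf_is_derive.
have Cb : is_derive (x 0 0) 1 (b - cst (o 0 1)) (derive1 b t - 0).
  by rewrite xt; apply: is_deriveB; exact: smoothf_is_derive.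
have Ca' : is_derive (next_parameter (curve_of a b) o x) 1 (derive1 a) (derive1 (derive1 a) u).
  by rewrite x0; apply: smoothf_is_derive; exact: smoothf_derive.
have Cb' : is_derive (next_parameter (curve_of a b) o x) 1 (derive1 b) (derive1 (derive1 b) u).
  by rewrite x0; apply: smoothf_is_derive; exact: smoothf_derive.
have D2 := is_diffB
  (is_diffM (is_diff_comp_derive Ca D0) (is_diff_comp_derive Cb' Dn))
  (is_diffM (is_diff_comp_derive Cb D0) (is_diff_comp_derive Ca' Dn)).
have D3 : is_diff x (fun y => dgen2 a b o (y 0 0) (next_parameter (curve_of a b) o y))
    (fun v => tangent_det a b t u * v 0 0 +
       dgen22 a b o t u * dnext a b o t u (v 0 0) (v 0 1)).
  apply: (is_diff_eq D2); apply/funext => v.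
  have alg (a1 b1 a2 b2 A B a3 b3 p d : R) :
    A * (d * b2) + b3 * (p * (a1 - 0)) - (B * (d * a2) + a3 * (p * (b1 - 0)))
    = (a1 * b3 - b1 * a3) * p + (A * b2 - B * a2) * d by clear; ring.
  rewrite xt x0.
  exact: (alg (derive1 a t) (derive1 b t) (derive1 (derive1 a) u) (derive1 (derive1 b) u)
    (a t - o 0 0) (b t - o 0 1) (derive1 a u) (derive1 b u) (v 0 0)
    (dnext a b o t u (v 0 0) (v 0 1))).
have := is_diff_mkpt Dn D3.
by rewrite -(gen2E o ov).
Qed.

End differentiability.

(** * The periodic orbit carried by the grid and its Jacobi field *)

Section grid_orbit.
Variable R : realType.
Implicit Types (a b : R -> R) (o : 'rV[R]_2).

(** The two properties of the interpolant from which the orbit and its Jacobi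
    field are obtained. *)
Definition grid_exact (n : nat) (f : R -> R) := forall t, on_grid n t ->
  derive1 f t = cdiff (step R n) f t /\
  derive1 (derive1 f) t = cdiff (step R n) (derive1 f) t.

Lemma step_gt0 n : (0 < n)%N -> 0 < step R n.
Proof. by move=> n0; rewrite divr_gt0 ?twopi_gt0// ltr0n. Qed.

(** The tangent at t + h is parallel to the chord from t to t + 2 h, so the
    determinant of the two tangents is a height, whose sign is known. *)
Lemma grid_tangent_det n a b t : (0 < n)%N -> grid_exact n a -> grid_exact n b ->
  on_grid n t ->
  tangent_det a b t (t + step R n) =
    tangent_height a b t (t + step R n + step R n) / (2 * step R n).
Proof.
move=> n0 ga gb gt; have [gp _] := on_grid_step gt.
rewrite /tangent_det (ga _ gp).1 (gb _ gp).1 /cdiff /tangent_height addrK.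
have alg (p q x y d : R) : p * (x / d) - q * (y / d) = (p * x - q * y) / d by ring.
exact: alg.
Qed.

Lemma grid_next_lt_star n a b t : (2 < n)%N -> oval a b -> grid_exact n a ->
  grid_exact n b -> on_grid n t ->
  t < t + step R n < star (curve_of a b) t.
Proof.
move=> n2 ov ga gb gt; have n0 : (0 < n)%N by exact: ltn_trans n2.
have h0 := step_gt0 n0.
have h2 : 2 * step R n < 2 * pi.
  rewrite /step mulrA ltr_pdivrMr ?ltr0n// mulrC ltr_pM2l ?twopi_gt0//.
  by rewrite ltr_nat.
have [_ _ lt_star] := star_spec t ov.
rewrite ltrDl h0 /=; apply: lt_star.
  by move: h0 h2; clear => ? ?; apply/andP; split; lra.
rewrite (grid_tangent_det n0 ga gb gt); apply: divr_gt0; last exact: mulr_gt0.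
by apply: (height_gt0 ov); move: h0 h2; clear => ? ?; apply/andP; split; lra.
Qed.

Definition orbit_point n a b o t : 'rV[R]_2 := mkpt t (- dgen1 a b o t (t + step R n)).

(** The billiard law at t + h asks that the tangent there be parallel to the
    chord from t to t + 2 h. *)
Lemma cover_map_orbit n a b o t : (2 < n)%N -> oval a b -> grid_exact n a ->
  grid_exact n b -> on_grid n t ->
  cover_map (curve_of a b) o (orbit_point n a b o t) =
  orbit_point n a b o (t + step R n).
Proof.
move=> n2 ov ga gb gt; have n0 : (0 < n)%N by exact: ltn_trans n2.
have [gp _] := on_grid_step gt.
have h0 : 2 * step R n != 0 by rewrite gt_eqF// mulr_gt0// step_gt0.
have ts := grid_next_lt_star n2 ov ga gb gt.
rewrite cover_mapE; have -> : next_parameter (curve_of a b) o (orbit_point n a b o t) =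
    t + step R n.
  apply: (next_parameterE ov); rewrite /orbit_point !mkptE; [exact: ts|reflexivity].
rewrite (gen2E o ov) /orbit_point !mkptE; congr (mkpt _ _).
have va := (ga _ gp).1; have vb := (gb _ gp).1.
rewrite /cdiff addrK in va vb.
rewrite /dgen2 /dgen1.
have alg (a0 b0 a2 b2 a1 b1 o0 o1 d : R) : d != 0 -> a1 = (a2 - a0) / d ->
    b1 = (b2 - b0) / d ->
    (a0 - o0) * b1 - (b0 - o1) * a1 = - (a1 * (b2 - o1) - b1 * (a2 - o0)).
  by move=> d0 -> ->; field.
exact: alg h0 va vb.
Qed.

(** The s-component of the tangent vector that induces the Jacobi field
    identically equal to 1. *)
Definition slope n a b o t : R :=
  - (dgen11 a b o t (t + step R n) + tangent_det a b t (t + step R n)).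

(** The first coordinate is preserved by the choice of the slope; the second one
    is the Jacobi equation at t + h, in which the second derivative cancels the
    difference of the neighbouring tangents. *)
Lemma is_diff_orbit n a b o t : (2 < n)%N -> oval a b -> grid_exact n a ->
  grid_exact n b -> on_grid n t ->
  differentiable (cover_map (curve_of a b) o) (orbit_point n a b o t) /\
  'd (cover_map (curve_of a b) o) (orbit_point n a b o t) (mkpt 1 (slope n a b o t)) =
    mkpt 1 (slope n a b o (t + step R n)).
Proof.
move=> n2 ov ga gb gt; have n0 : (0 < n)%N by exact: ltn_trans n2.
have [gp _] := on_grid_step gt.
have h0 : 2 * step R n != 0 by rewrite gt_eqF// mulr_gt0// step_gt0.
have ts := grid_next_lt_star n2 ov ga gb gt.
have D := is_diff_cover_map o ov ts.
have [_ pos _] := star_spec t ov.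
have d0 : tangent_det a b t (t + step R n) != 0 by rewrite gt_eqF// pos.
split; first exact: ex_diff.
rewrite (diff_val (is_diff_def := D)) !mkptE.
have dn : dnext a b o t (t + step R n) 1 (slope n a b o t) = 1.
  rewrite /dnext /slope.
  have alg (x y : R) : y != 0 -> - (- (x + y) + x * 1) / y = 1.
    by move=> y0; field.
  exact: alg.
rewrite /= dn; congr (mkpt _ _).
have va := (ga _ gp).1; have vb := (gb _ gp).1.
have wa := (ga _ gp).2; have wb := (gb _ gp).2.
rewrite /cdiff addrK in va vb wa wb.
rewrite /slope /dgen22 /dgen11 /tangent_det.
have alg (xm ym x2 y2 am bm a1 b1 ap bp A B o0 o1 d : R) : d != 0 ->
    a1 = (x2 - xm) / d -> b1 = (y2 - ym) / d -> A = (ap - am) / d -> B = (bp - bm) / d ->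
    (am * b1 - bm * a1) * 1 + ((xm - o0) * B - (ym - o1) * A) * 1 =
    - (A * (y2 - o1) - B * (x2 - o0) + (a1 * bp - b1 * ap)).
  by move=> d0' -> -> -> ->; field.
exact: alg h0 va vb wa wb.
Qed.

Lemma on_grid_add n t k : on_grid n t -> on_grid n (t + step R n *+ k).
Proof.
move=> gt; elim: k => [|k IH]; first by rewrite mulr0n addr0.
by rewrite mulrSr addrA; have [] := on_grid_step IH.
Qed.

Lemma iter_cover_map n a b o t k : (2 < n)%N -> oval a b -> grid_exact n a ->
  grid_exact n b -> on_grid n t ->
  [/\ iter k (cover_map (curve_of a b) o) (orbit_point n a b o t) =
        orbit_point n a b o (t + step R n *+ k),
      differentiable (iter k (cover_map (curve_of a b) o)) (orbit_point n a b o t)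
    & 'd (iter k (cover_map (curve_of a b) o)) (orbit_point n a b o t)
        (mkpt 1 (slope n a b o t)) = mkpt 1 (slope n a b o (t + step R n *+ k))].
Proof.
move=> n2 ov ga gb gt; set F := cover_map _ _; elim: k => [|k [IH1 IH2 IH3]].
  have -> : iter 0 F = id by [].
  have Did := is_diff_id (orbit_point n a b o t).
  rewrite mulr0n addr0; split=> //.
  by rewrite (diff_val (is_diff_def := Did)).
have gk := on_grid_add k gt.
have [D1 D2] := is_diff_orbit o n2 ov ga gb gk.
rewrite -/F -IH1 in D1 D2.
have -> : iter k.+1 F = F \o iter k F by [].
split; first by rewrite /= IH1 /F (cover_map_orbit o n2 ov ga gb gk) mulrSr addrA.
  exact: differentiable_comp IH2 D1.
apply: etrans (congr1 (fun L => L (mkpt 1 (slope n a b o t))) (diff_comp IH2 D1)) _.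
rewrite mulrSr addrA -D2.
exact: (congr1 (fun v => 'd F (iter k F (orbit_point n a b o t)) v) IH3).
Qed.

Lemma step_muln n : (0 < n)%N -> step R n *+ n = 2 * pi.
Proof.
move=> n0; rewrite -[LHS]mulr_natr /step divfK// pnatr_eq0 -lt0n //.
Qed.

Lemma orbit_point_periodic n a b o t (k : int) : oval a b ->
  orbit_point n a b o (t + k%:~R * (2 * pi)) =
  mkpt (t + k%:~R * (2 * pi)) (orbit_point n a b o t 0 1).
Proof.
move=> [sa sb [pa pb] _ _]; rewrite /orbit_point mkptE /dgen1 [t + _ + step R n]addrAC.
by rewrite !periodic_int//; apply: periodic_derive1.
Qed.

Lemma slope_periodic n a b o t : oval a b ->
  slope n a b o (t + 2 * pi) = slope n a b o t.
Proof.
move=> [sa sb [pa pb] _ _].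
have pa' := periodic_derive1 sa pa; have pb' := periodic_derive1 sb pb.
have pa'' := periodic_derive1 (smoothf_derive sa) pa'.
have pb'' := periodic_derive1 (smoothf_derive sb) pb'.
rewrite /slope /dgen11 /tangent_det [t + 2 * pi + step R n]addrAC.
by rewrite !pa'' !pb'' !pa' !pb' !pa !pb.
Qed.

End grid_orbit.

(** * Tables with a parabolic periodic point are dense *)

Section parabolic_orbit.
Variable R : realType.
Implicit Types (a b : R -> R) (o : 'rV[R]_2).

Lemma fixed_vector_not_hyperbolic (A : 'M[R]_2) (v : 'rV[R]_2) :
  v != 0 -> v *m A = v -> ~ hyperbolic_mx A.
Proof.
move=> v0 vA hA; have : eigenvalue (map_mx (real_complex R) A) 1.
  apply/eigenvalueP; exists (map_mx (real_complex R) v); last by rewrite map_mx_eq0.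
  by rewrite -map_mxM vA scale1r.
by move=> /hA; rewrite normr1 eqxx.
Qed.

Lemma least_period_uniq gamma o (m n : nat) (x : circle R * R) :
  least_period gamma o m x -> least_period gamma o n x -> m = n.
Proof.
move=> [_ m0 mx mmin] [_ n0 nx nmin]; case: (ltngtP m n) => // lt.
  by case: (nmin m); rewrite ?m0.
by case: (mmin n); rewrite ?n0.
Qed.

Definition orbit_pt n a b o (t : R) : circle R * R := to_cylinder (orbit_point n a b o t).

Lemma orbit_pt_periodic n a b o t (k : int) : oval a b ->
  orbit_pt n a b o (t + k%:~R * (2 * pi)) = orbit_pt n a b o t.
Proof.
move=> ov; rewrite /orbit_pt orbit_point_periodic// /to_cylinder !mkptE; congr pair.
by apply/esym/to_circleP; exists k.
Qed.

(** The representative of a point of the circle is arbitrary, so the orbit is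
    described at all translates of the parameter. *)
Lemma of_orbit_pt n a b o t : oval a b -> exists k : int,
  of_cylinder (orbit_pt n a b o t) = orbit_point n a b o (t + k%:~R * (2 * pi)).
Proof.
move=> ov; have [k kE] := repr_to_circle t; exists k.
by rewrite orbit_point_periodic// /of_cylinder /orbit_pt /to_cylinder /= {1}/orbit_point !mkptE kE.
Qed.

Lemma on_grid_turn n (t : R) (k : int) : (0 < n)%N -> on_grid n t -> on_grid n (t + k%:~R * (2 * pi)).
Proof.
move=> n0 [j ->]; exists (j + k * n%:Z); rewrite -(step_muln R n0) -mulr_natl.
by rewrite intrD intrM mulrDl -(mulrA k%:~R).
Qed.

Lemma billiard_orbit n a b o t : (2 < n)%N -> oval a b -> grid_exact n a ->
  grid_exact n b -> on_grid n t ->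
  billiard (curve_of a b) o (orbit_pt n a b o t) = orbit_pt n a b o (t + step R n).
Proof.
move=> n2 ov ga gb gt; have n0 : (0 < n)%N by exact: ltn_trans n2.
have [k kE] := of_orbit_pt n o t ov.
rewrite /billiard kE (cover_map_orbit o n2 ov ga gb (on_grid_turn k n0 gt)).
by rewrite -/(orbit_pt n a b o _) addrAC orbit_pt_periodic.
Qed.

Lemma iter_billiard_orbit n a b o t k : (2 < n)%N -> oval a b -> grid_exact n a ->
  grid_exact n b -> on_grid n t ->
  iter k (billiard (curve_of a b) o) (orbit_pt n a b o t) =
  orbit_pt n a b o (t + step R n *+ k).
Proof.
move=> n2 ov ga gb gt; elim: k => [|k IH]; first by rewrite mulr0n addr0.
rewrite iterS IH (billiard_orbit o n2 ov ga gb (on_grid_add k gt)).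
by rewrite mulrSr addrA.
Qed.

Lemma phase_orbit_pt n a b o t : (2 < n)%N -> oval a b -> grid_exact n a ->
  grid_exact n b -> on_grid n t -> phase (curve_of a b) o (orbit_pt n a b o t).
Proof.
move=> n2 ov ga gb gt; exists (orbit_point n a b o t) => //.
rewrite /cover_phase /= (gen1E o ov) /orbit_point !mkptE !ltrN2.
have /andP[h1 h2] := grid_next_lt_star n2 ov ga gb gt.
by rewrite !dgen1_incr// ltW.
Qed.

(** The points of one turn of the grid are distinct on the circle. *)
Lemma least_period_orbit_pt n a b o t : (2 < n)%N -> oval a b -> grid_exact n a ->
  grid_exact n b -> on_grid n t ->
  least_period (curve_of a b) o n (orbit_pt n a b o t).
Proof.
move=> n2 ov ga gb gt; have n0 : (0 < n)%N by exact: ltn_trans n2.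
split=> //; first exact: phase_orbit_pt.
  rewrite (iter_billiard_orbit o n n2 ov ga gb gt) (step_muln R n0).
  by rewrite -[2 * pi]mul1r (orbit_pt_periodic n o t 1 ov).
move=> k /andP[k0 kn]; rewrite (iter_billiard_orbit o k n2 ov ga gb gt).
rewrite /orbit_pt /to_cylinder /orbit_point !mkptE => -[/to_circleP[j jE] _].
have kj : (k%:~R : R) = (- j * n%:Z)%:~R.
  have s0 : step R n != 0 by rewrite gt_eqF// step_gt0.
  apply: (mulIf s0); rewrite intrM mulrNz -pmulrn -mulrA mulr_natl.
  rewrite [n%:~R * _]mulr_natl (step_muln R n0) mulNr.
  by move: jE; set y := step R n *+ k; set z := _ * (2 * pi); clear; lra.
have {}kj : (k : int) = - j * n%:Z by move/eqP: kj; rewrite eqr_int => /eqP.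
have : (n %| k)%N by rewrite -[k]absz_nat kj abszM dvdn_mull.
by move=> /(dvdn_leq k0); rewrite leqNgt kn.
Qed.

Lemma orbit_pt_not_hyperbolic n a b o t : (2 < n)%N -> oval a b -> grid_exact n a ->
  grid_exact n b -> on_grid n t ->
  ~ hyperbolic_periodic (curve_of a b) o (orbit_pt n a b o t).
Proof.
move=> n2 ov ga gb gt [m pm]; have n0 : (0 < n)%N by exact: ltn_trans n2.
rewrite (least_period_uniq pm (least_period_orbit_pt o n2 ov ga gb gt)).
have [k kE] := of_orbit_pt n o t ov; rewrite /Dbilliard kE.
set s := t + _; have gs : on_grid n s by exact: on_grid_turn.
have [_ _ dE] := iter_cover_map o n n2 ov ga gb gs.
rewrite (step_muln R n0) (slope_periodic n o s ov) in dE.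
apply: (@fixed_vector_not_hyperbolic _ (mkpt 1 (slope n a b o s))).
  apply/eqP => /rowP/(_ 0); rewrite mkptE mxE => /eqP; exact/negP/oner_neq0.
by rewrite /jacobian mul_rV_lin1.
Qed.

Lemma enorm_lt (v : 'rV[R]_2) (e : R) : `|v 0 0| < e / 2 -> `|v 0 1| < e / 2 ->
  enorm v < e.
Proof.
move=> v0 v1; have e0 : 0 < e.
  by have := le_lt_trans (normr_ge0 _) v0; rewrite pmulr_lgt0// invr_gt0.
rewrite /enorm !big_ord_recl big_ord0 addr0.
have -> : lift ord0 ord0 = 1 :> 'I_2 by exact/val_inj.
rewrite -[ltRHS](ger0_norm (ltW e0)) -sqrtr_sqr ltr_sqrt ?exprn_gt0//.
have sq (x : R) : `|x| < e / 2 -> x ^+ 2 < (e / 2) ^+ 2.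
  by move=> xe; rewrite -real_normK ?num_real// ltr_pXn2r// nnegrE ltW// divr_gt0.
have := sq _ v0; have := sq _ v1; move: (exprn_gt0 2 e0); clear.
set x := v 0 0 ^+ 2; set y := v 0 1 ^+ 2; rewrite expr_div_n; lra.
Qed.

(** The perturbed table may have another origin than the original one; the
    Jacobi equation does not involve it. *)
Theorem C2_interior_empty
    (origin : (circle R -> 'rV[R]_2) -> 'rV[R]_2)
    (horigin : forall gamma, tables gamma -> (table gamma)° (origin gamma))
    (p : nat) (gamma : circle R -> 'rV[R]_2) :
  ~ C2_interior (eventually_hyperbolic origin p) gamma.
Proof.
move=> [tg [eps eps0 sub]].
have ov := table_oval tg (horigin _ tg).
set a := xcoord gamma in ov; set b := ycoord gamma in ov.
have [sa sb [pa pb] _ _] := ov.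
have [e1 e10 open] := oval_open ov.
pose e := Num.min e1 (eps / 2).
have e0 : 0 < e by rewrite lt_min e10 divr_gt0.
have ee1 : e <= e1 by rewrite ge_min lexx.
have ee2 : e <= eps / 2 by rewrite ge_min lexx orbT.
have [na Ha] := grid_interp_close e0 sa pa.
have [nb Hb] := grid_interp_close e0 sb pb.
pose n := (maxn (maxn na nb) (maxn p 3)).
(* three points per turn are needed for t + 2 h to precede t + 2 pi *)
have n2 : (2 < n)%N by rewrite /n !leq_max leqnn !orbT.
have n0 : (0 < n)%N by exact: ltn_trans n2.
have pn : (p <= n)%N by rewrite /n !leq_max leqnn !orbT.
have nan : (na <= n)%N by rewrite /n !leq_max leqnn.
have nbn : (nb <= n)%N by rewrite /n !leq_max leqnn !orbT.
pose a1 := grid_interp n a; pose b1 := grid_interp n b.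
have sa1 : smoothf a1 := smoothf_grid_interp n sa.
have sb1 : smoothf b1 := smoothf_grid_interp n sb.
have pa1 : periodic a1 (2 * pi) := periodic_grid_interp n sa pa.
have pb1 : periodic b1 (2 * pi) := periodic_grid_interp n sb pb.
have ga : grid_exact n a1 by move=> t; exact: grid_interp_on_grid.
have gb : grid_exact n b1 by move=> t; exact: grid_interp_on_grid.
have ov1 : oval a1 b1.
  apply: open => // k t k2; apply: lt_le_trans ee1; [exact: Ha|exact: Hb].
have E k i : derive1n k (fun t => lift_curve gamma t 0 i) =
    (fun t => dcurve gamma k t 0 i).
  by case: tg => smo _ _ _ _; exact: derive1n_coord.
have [_ hyp] : eventually_hyperbolic origin p (curve_of a1 b1).
  apply: sub; split; first exact: oval_table.
  move=> k t k2; rewrite (dcurve_of k sa1 sb1 pa1 pb1); apply: enorm_lt.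
    rewrite mxE mkptE mxE -[dcurve gamma k t 0 0]/((fun t => dcurve gamma k t 0 0) t) -E.
    exact: lt_le_trans (Ha n nan n0 k t k2) ee2.
  rewrite mxE mkptE mxE -[dcurve gamma k t 0 1]/((fun t => dcurve gamma k t 0 1) t) -E.
  exact: lt_le_trans (Hb n nbn n0 k t k2) ee2.
have g0 : on_grid n (0 : R) by exists 0; rewrite mul0r.
have lp := least_period_orbit_pt (origin (curve_of a1 b1)) n2 ov1 ga gb g0.
exact: orbit_pt_not_hyperbolic n2 ov1 ga gb g0 (hyp _ _ pn lp).
Qed.

End parabolic_orbit.

Theorem theorem5p5 (R : realType)
    (origin : (circle R -> 'rV[R]_2) -> 'rV[R]_2)
    (horigin : forall gamma, tables gamma -> (table gamma)° (origin gamma))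
    (p : nat) (hp : (3 <= p)%N) (gamma : circle R -> 'rV[R]_2)
    (hgamma : C2_interior (eventually_hyperbolic origin p) gamma) :
  hyperbolic_set gamma (origin gamma)
    (closure (hyperbolic_periodic gamma (origin gamma))).
Proof. by case: (C2_interior_empty horigin hgamma). Qed.
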